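(* Let $d\in\mathbb{N}$, $1\le p\le\infty$, $1\le q\le\infty$ and $s>0$, and suppose that either $s<d/p$, or $s=d/p$ and $q>1$. Let $U$ be the closed unit ball of $B^s_{pq}(\mathbb{R}^d)$ and let $\mathcal{U}$ be any set of functions obtained by selecting one arbitrary representative from every equivalence class $[f]_\lambda\in U$. Let $\mathbb{P}$ be a probability measure on $\mathbb{R}^d$ possessing a bounded density with respect to Lebesgue measure. Then $\mathcal{U}$ is not a $\mathbb{P}$-Donsker class.
   Context: $\lambda$ is Lebesgue measure on $\mathbb{R}^d$, $\|h\|_{r,\mu}=(\int|h|^r d\mu)^{1/r}$ (essential supremum if $r=\infty$). Besov spaces: fix a $C^\infty$ function $\varphi_0$ on $\mathbb{R}^d$ with $\varphi_0(x)=1$ for $\|x\|\le1$, $\varphi_0(x)=0$ for $\|x\|\ge3/2$; put $\varphi_1(x)=\varphi_0(x/2)-\varphi_0(x)$, $\varphi_k(x)=\varphi_1(2^{-k+1}x)$. For a tempered distribution $T$, $\|T\|_{s,p,q,\lambda}=\big(\sum_{k\ge0}2^{ksq}\|F^{-1}(\varphi_kFT)\|_{p,\lambda}^q\big)^{1/q}$ (sup-modification for $q=\infty$), $F$ the Fourier transform. $B^s_{pq}(\mathbb{R}^d)$ is the space of real tempered distributions with finite norm; for $s>0$ its elements are equivalence classes (modulo Lebesgue-a.e. equality) of $p$-integrable functions. For a class $\mathcal{F}$ of functions, a Brownian bridge on $\mathcal{F}$ is a centered Gaussian process $\mathbb{G}$ with covariance $E\mathbb{G}(f)\mathbb{G}(g)=\mathbb{P}[(f-\mathbb{P}f)(g-\mathbb{P}g)]$,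 semimetric $\rho(f,g)=(E[\mathbb{G}(f)-\mathbb{G}(g)]^2)^{1/2}$; $\mathcal{F}\subseteq\mathcal{L}^2(\mathbb{P})$ is $\mathbb{P}$-pregaussian if such $\mathbb{G}$ exists with all sample paths bounded and uniformly $\rho$-continuous. With $X_1,X_2,\dots$ i.i.d. $\mathbb{P}$ (canonical model), $\mathbb{P}_n=n^{-1}\sum_{i=1}^n\delta_{X_i}$ and empirical process $\nu_n(f)=\sqrt n(\mathbb{P}_n-\mathbb{P})f$, $\mathcal{F}$ is $\mathbb{P}$-Donsker if it is $\mathbb{P}$-pregaussian and $\nu_n$ converges in law (in the Hoffmann-Jørgensen sense) in $\ell^\infty(\mathcal{F})$, the space of bounded real functions on $\mathcal{F}$ with sup norm, to a Brownian bridge on $\mathcal{F}$. *)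

(* Defs.v *)
From HB Require Import structures.
From mathcomp Require Import all_boot all_order all_algebra.
From mathcomp Require Import all_classical all_reals all_analysis.
From mathcomp Require Import measurable_realfun.

Set Implicit Arguments.
Unset Strict Implicit.
Unset Printing Implicit Defensive.

Import Order.TTheory GRing.Theory Num.Theory.
Import numFieldNormedType.Exports.

Local Open Scope classical_set_scope.
Local Open Scope ring_scope.

Section Defs.
Variable R : realType.

Definition Rd (d : nat) := 'I_d -> R.

Definition consRd (d : nat) (x : R) (y : Rd d) : Rd d.+1 :=
  fun i => if unlift ord0 i is Some j then y j else x.

(** Lebesgue integral over R^d of a nonnegative extended function, as the
    iterated one-dimensional Lebesgue integral (Tonelli). *)
Fixpoint iint (d : nat) : (Rd d -> \bar R) -> \bar R :=
  match d return (Rd d -> \bar R) -> \bar R with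
  | 0 => fun f => f (fun _ => 0)
  | d'.+1 => fun f =>
      (\int[@lebesgue_measure R]_(x in setT) iint (fun y => f (consRd x y)))%E
  end.

Definition rd_gen (d : nat) : set (set (Rd d)) :=
  [set A | exists (i : 'I_d) (B : set R), measurable B /\ A = (fun x => x i) @^-1` B].
Definition borelRd (d : nat) (A : set (Rd d)) : Prop := <<s @rd_gen d >> A.
Definition bmeas (d : nat) (f : Rd d -> R) : Prop :=
  forall B : set R, measurable B -> borelRd (f @^-1` B).

Definition lam (d : nat) (A : set (Rd d)) : \bar R := iint (fun x => (\1_A x)%:E).

Definition nullw (d : nat) (mu : set (Rd d) -> \bar R) (N : set (Rd d)) : Prop :=
  exists A, [/\ borelRd A, N `<=` A & mu A = 0%E].
Definition aeq (d : nat) (mu : set (Rd d) -> \bar R) (f h : Rd d -> R) : Prop :=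
  exists N, nullw mu N /\ forall x, ~ N x -> f x = h x.

Definition sint (d : nat) (f : Rd d -> R) : \bar R :=
  (iint (fun x => (Num.max (f x) 0)%:E) - iint (fun x => (Num.max (- f x) 0)%:E))%E.

Definition Lpn (d : nat) (p : \bar R) (f : Rd d -> R) : \bar R :=
  if p == +oo%E then
    ereal_inf [set M%:E | M in [set M : R | 0 <= M /\ nullw (@lam d) [set x | M < `|f x|]]]
  else poweR (iint (fun x => (powR `|f x| (fine p))%:E)) (fine p)^-1.

Definition inLp (d : nat) (p : \bar R) (f : Rd d -> R) : Prop :=
  bmeas f /\ (Lpn p f < +oo)%E.

Definition dotRd (d : nat) (x y : Rd d) : R := \sum_(i < d) x i * y i.
Definition enorm (d : nat) (x : Rd d) : R := Num.sqrt (\sum_(i < d) x i ^+ 2).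
Definition scaleRd (d : nat) (c : R) (x : Rd d) : Rd d := fun i => c * x i.
Definition subRd (d : nat) (x y : Rd d) : Rd d := fun i => x i - y i.
Definition basisRd (d : nat) (i : 'I_d) : Rd d := fun j => (j == i)%:R.
Definition lineRd (d : nat) (x : Rd d) (i : 'I_d) (t : R) : Rd d :=
  fun j => x j + t * basisRd i j.

Definition pder (d : nat) (i : 'I_d) (g : Rd d -> R) : Rd d -> R :=
  fun x => derive1 (fun t : R => g (lineRd x i t)) 0.
Definition Dseq (d : nat) (s : seq 'I_d) (g : Rd d -> R) : Rd d -> R :=
  foldr (fun i G => pder i G) g s.
Definition contRd (d : nat) (g : Rd d -> R) : Prop :=
  forall (x : Rd d) (e : R), 0 < e -> exists2 dl : R, 0 < dl &
    forall y : Rd d, (forall i, `|y i - x i| < dl) -> `|g y - g x| < e.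
Definition smoothRd (d : nat) (g : Rd d -> R) : Prop :=
  forall s : seq 'I_d, contRd (Dseq s g) /\
    forall (i : 'I_d) (x : Rd d), derivable (fun t : R => Dseq s g (lineRd x i t)) 0 1.

Definition is_phi0 (d : nat) (phi0 : Rd d -> R) : Prop :=
  [/\ smoothRd phi0,
      forall x, enorm x <= 1 -> phi0 x = 1 &
      forall x, 3 / 2 <= enorm x -> phi0 x = 0].

Definition phik (d : nat) (phi0 : Rd d -> R) (k : nat) (xi : Rd d) : R :=
  if k is k'.+1 then phi0 (scaleRd (2 ^- k) xi) - phi0 (scaleRd (2 ^- k') xi)
  else phi0 xi.

(** real and imaginary parts of F^{-1} phi_k, with
    F f (xi) = int f(x) e^{-i x.xi} dx,  F^{-1} g (x) = (2 pi)^{-d} int g(xi) e^{i x.xi} dxi *)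
Definition psic (d : nat) (phi0 : Rd d -> R) (k : nat) (x : Rd d) : R :=
  (pi *+ 2) ^- d * fine (sint (fun xi => phik phi0 k xi * cos (dotRd x xi))).
Definition psis (d : nat) (phi0 : Rd d -> R) (k : nat) (x : Rd d) : R :=
  (pi *+ 2) ^- d * fine (sint (fun xi => phik phi0 k xi * sin (dotRd x xi))).

(** modulus of F^{-1}(phi_k F f) = f * F^{-1} phi_k *)
Definition LPpiece (d : nat) (phi0 : Rd d -> R) (k : nat) (f : Rd d -> R)
    (x : Rd d) : R :=
  let re := fine (sint (fun y => f y * psic phi0 k (subRd x y))) in
  let im := fine (sint (fun y => f y * psis phi0 k (subRd x y))) in
  Num.sqrt (re ^+ 2 + im ^+ 2).

Definition besov (d : nat) (phi0 : Rd d -> R) (s : R) (p q : \bar R)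
    (f : Rd d -> R) : \bar R :=
  let a k := ((powR 2 (k%:R * s))%:E * Lpn p (LPpiece phi0 k f))%E in
  if q == +oo%E then ereal_sup (range a)
  else poweR (\sum_(0 <= k <oo) poweR (a k) (fine q))%E (fine q)^-1.

Definition besov_ball (d : nat) (phi0 : Rd d -> R) (s : R) (p q : \bar R)
    (f : Rd d -> R) : Prop :=
  inLp p f /\ (besov phi0 s p q f <= 1)%E.

Definition rep_set (d : nat) (phi0 : Rd d -> R) (s : R) (p q : \bar R)
    (UU : set (Rd d -> R)) : Prop :=
  (forall u, UU u -> exists f, besov_ball phi0 s p q f /\ aeq (@lam d) u f) /\
  (forall f, besov_ball phi0 s p q f -> exists! u, UU u /\ aeq (@lam d) u f).

Definition is_bdd_density (d : nat) (g : Rd d -> R) : Prop :=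
  [/\ bmeas g, forall x, 0 <= g x, exists M : R, forall x, g x <= M &
      iint (fun x => (g x)%:E) = 1%E].

Definition Pm (d : nat) (g : Rd d -> R) (A : set (Rd d)) : \bar R :=
  iint (fun x => (\1_A x * g x)%:E).

Definition pvers (d : nat) (g : Rd d -> R) (u f : Rd d -> R) : Prop :=
  bmeas f /\ aeq (Pm g) u f.
Definition L2P (d : nat) (g : Rd d -> R) (u : Rd d -> R) : Prop :=
  exists f, pvers g u f /\ (iint (fun x => (f x ^+ 2 * g x)%:E) < +oo)%E.
Definition Pmean (d : nat) (g : Rd d -> R) (f : Rd d -> R) : R :=
  fine (sint (fun x => f x * g x)).
(** P u (well defined for u in L^2(P)) *)
Definition Pu (d : nat) (g : Rd d -> R) (u : Rd d -> R) : R :=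
  xget 0 [set m | exists f, pvers g u f /\ m = Pmean g f].

Definition Om (d : nat) := nat -> Rd d.
Definition cyl (d : nat) : set (set (Om d)) :=
  [set A | exists (n : nat) (i : 'I_d) (B : set R),
     measurable B /\ A = (fun w : Om d => w n i) @^-1` B].
Definition OmT (d : nat) := g_sigma_algebraType (@cyl d).

Definition is_product (d : nat) (g : Rd d -> R) (Q : probability (OmT d) R) : Prop :=
  forall (n : nat) (A : nat -> set (Rd d)), (forall i, borelRd (A i)) ->
    Q [set w : OmT d | forall i, (i < n)%N -> A i (w i)] = (\prod_(i < n) Pm g (A i))%E.

Definition empproc (d : nat) (g : Rd d -> R) (n : nat) (u : Rd d -> R)
    (w : Om d) : R :=
  Num.sqrt n%:R * (n%:R^-1 * \sum_(i < n) u (w i) - Pu g u).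

Definition oexp {d'} {T : measurableType d'} (Q : probability T R) (Z : T -> R) : \bar R :=
  ereal_inf [set (\int[Q]_w Y w)%E | Y in
    [set Y : T -> \bar R | measurable_fun [set: T] Y /\ forall w, ((Z w)%:E <= Y w)%E]].

Definition brownian_bridge (d : nat) (g : Rd d -> R) (F : set (Rd d -> R))
    {d'} {T : measurableType d'} (Q : probability T R)
    (G : (Rd d -> R) -> T -> R) : Prop :=
  [/\ forall u, F u -> measurable_fun setT (G u),
      (forall (n : nat) (us : 'I_n -> Rd d -> R) (a : 'I_n -> R),
        (forall i, F (us i)) ->
        let Y := fun w => \sum_(i < n) a i * G (us i) w in
        exists sig : R, 0 <= sig /\
          (if sig == 0 then Q [set w | Y w <> 0] = 0%E
           else forall B : set R, measurable B -> Q (Y @^-1` B) = normal_prob 0 sig B)) &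
      forall u v f1 f2, F u -> F v -> pvers g u f1 -> pvers g v f2 ->
        (\int[Q]_w (G u w * G v w)%:E)%E =
        sint (fun x => (f1 x - Pmean g f1) * (f2 x - Pmean g f2) * g x)].

Definition rho {d'} {T : measurableType d'} (Q : probability T R) (d : nat)
    (G : (Rd d -> R) -> T -> R) (u v : Rd d -> R) : R :=
  Num.sqrt (fine (\int[Q]_w ((G u w - G v w) ^+ 2)%:E)%E).

Definition good_paths (d : nat) (F : set (Rd d -> R))
    {d'} {T : measurableType d'} (Q : probability T R)
    (G : (Rd d -> R) -> T -> R) : Prop :=
  forall w, (exists M : R, forall u, F u -> `|G u w| <= M) /\
    forall e : R, 0 < e -> exists2 dl : R, 0 < dl &
      forall u v, F u -> F v -> rho Q G u v < dl -> `|G u w - G v w| < e.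

(** bounded continuous real functions on l^oo(F) (represented as functions on
    Rd d -> R depending only on the values on F) *)
Definition bdd_on (d : nat) (F : set (Rd d -> R)) (z : (Rd d -> R) -> R) : Prop :=
  exists M : R, forall u, F u -> `|z u| <= M.
Definition bc_fun (d : nat) (F : set (Rd d -> R)) (h : ((Rd d -> R) -> R) -> R) : Prop :=
  [/\ exists M : R, forall z, `|h z| <= M,
      forall z z', (forall u, F u -> z u = z' u) -> h z = h z' &
      forall z (e : R), bdd_on F z -> 0 < e -> exists2 dl : R, 0 < dl &
        forall z', bdd_on F z' -> (forall u, F u -> `|z u - z' u| <= dl) ->
          `|h z - h z'| < e].

Definition donsker (d : nat) (g : Rd d -> R) (F : set (Rd d -> R))
    (Q : probability (OmT d) R) : Prop :=
  (forall u, F u -> L2P g u) /\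
  exists (d' : measure_display) (T : measurableType d') (Q' : probability T R)
         (G : (Rd d -> R) -> T -> R),
    [/\ brownian_bridge g F Q' G, good_paths F Q' G &
        forall h, bc_fun F h ->
          (fun n => oexp Q (fun w : OmT d => h (fun u => empproc g n u w)))
            @ \oo --> oexp Q' (fun w => h (fun u => G u w))].

End Defs.

HB.instance Definition _ (R : realType) (d : nat) := Pointed.on (Om R d).

(* Main.v *)
Require Import Defs.
From HB Require Import structures.
From mathcomp Require Import all_boot all_order all_algebra.
From mathcomp Require Import all_classical all_reals all_analysis.
From mathcomp Require Import measurable_realfun.
From mathcomp Require Import ring lra.

Import Order.TTheory GRing.Theory Num.Theory.
Import numFieldNormedType.Exports.
Local Open Scope classical_set_scope.
Local Open Scope ring_scope.

(** The Donsker property fails for a crude reason: for every sample size n >= 1 the empirical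
    process is almost surely unbounded on [UU]. Take the functional [h] equal to 1 on bounded
    functions on [UU] and to 0 elsewhere; it is an admissible test functional, because continuity is
    only asked among bounded functions. A process with bounded paths gives it outer expectation at
    least 1. Under the law of the sample it vanishes outside a null event, so the limit of the outer
    expectations is at most 0.

    Unboundedness comes from spikes c_N * sum_{j<N} eta_j(x - r), with eta_j concentrated at scale
    2^-j around 0. Each eta_j is a tensor product of modulated Fejer kernels, so its Fourier
    transform is a product of triangles, supported in an annulus where phi_j = 1 and every other
    phi_k vanishes. Hence the k-th Littlewood-Paley piece of a spike is exactly a multiple of eta_k
    or zero ([LPpiece_spike]), and its weighted L^p norm is O(c_N 2^(k(s-d/p)))
    ([besov_spike_term]). For s < d/p these bounds are summable; for s = d/p they are constant over
    N scales, and their l^q norm costs a factor of order N^(1/q). Either way the spikes fit in the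
    unit ball with c_N * N unbounded ([spike_family]).

    A spike is at least a fixed multiple of c_N * N within 2^-N of its centre ([spike_near]) and
    bounded below everywhere by a constant independent of N and r ([spike_ge]). Its L^1 norm is
    bounded uniformly ([hasint_abs_spike_le]), so the bounded density keeps its mean bounded
    ([Pu_bound]). A rational centre close to the first observation therefore makes the empirical
    process arbitrarily large. Only countably many spikes occur, so almost surely their arbitrary
    representatives agree with them at all sample points ([sample_null]). [not_donsker_succ]
    assembles the argument in positive dimension. *)

(** * Lebesgue measure on R^d and the iterated integral *)

Section LebesgueRd.
Context {R : realType}.

Local Notation RdT d := (g_sigma_algebraType (@rd_gen R d)).

Lemma measurable_coord {d} (i : 'I_d) : measurable_fun [set: RdT d] (fun x => x i).
Proof.
move=> _ B mB; rewrite setTI; apply: sub_sigma_algebra.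
by exists i, B.
Qed.

Lemma measurable_fun_Rd d' (T : measurableType d') d (f : T -> RdT d) :
  (forall i, measurable_fun setT (fun t => f t i)) -> measurable_fun setT f.
Proof.
move=> mf; apply: (@measurability _ _ T (RdT d) setT f (@rd_gen R d)); first by [].
move=> _ [_ [i [B [mB ->]]] <-].
exact: mf.
Qed.

Definition consp d (z : measurableTypeR R * RdT d) : RdT d.+1 := consRd z.1 z.2.
Definition unconsp d (x : RdT d.+1) : measurableTypeR R * RdT d :=
  (x ord0, fun i => x (lift ord0 i)).

Lemma consRd0 d (t : R) (y : Rd R d) : consRd t y ord0 = t.
Proof. by rewrite /consRd unlift_none. Qed.

Lemma consRdS d (t : R) (y : Rd R d) i : consRd t y (lift ord0 i) = y i.
Proof. by rewrite /consRd liftK. Qed.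

Lemma unconspK d : cancel (@unconsp d) (@consp d).
Proof.
move=> x; apply/funext => i; rewrite /consp /consRd /=.
by case: unliftP => [j|] ->.
Qed.

Lemma conspK d : cancel (@consp d) (@unconsp d).
Proof.
move=> [t y]; rewrite /unconsp /consp consRd0; congr pair.
by apply/funext => i; rewrite consRdS.
Qed.

Lemma measurable_consp d : measurable_fun setT (@consp d).
Proof.
apply: measurable_fun_Rd => i; rewrite /consp /consRd.
case: unliftP => [j|] _.
  exact: (measurableT_comp (measurable_coord j) measurable_snd).
exact: measurable_fst.
Qed.

Lemma measurable_unconsp d : measurable_fun setT (@unconsp d).
Proof.
apply/measurable_fun_pairP; split; first exact: measurable_coord.
by apply: measurable_fun_Rd => i; exact: measurable_coord.
Qed.

Section cons_measure.
Context (d : nat) (mu : {sigma_finite_measure set (RdT d) -> \bar R}).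

Definition cons_measure : set (RdT d.+1) -> \bar R :=
  pushforward (@lebesgue_measure R \x mu)%E (@consp d).

HB.instance Definition _ := Measure.copy cons_measure
  (measure_function_pushforward__canonical__measure_function_Measure
    (@lebesgue_measure R \x mu)%E (measurable_consp d)).

(** Sigma-finiteness must travel along the recursion on the dimension, since Tonelli in the next
    dimension asks for it. *)
Lemma sigma_finite_cons_measure : sigma_finite setT cons_measure.
Proof.
have /sigma_finiteP[F [FT ndF Foo]] := sigma_finiteT (@lebesgue_measure R).
have /sigma_finiteP[G [GT ndG Goo]] := sigma_finiteT mu.
exists (fun n => @unconsp d @^-1` (F n `*` G n)).
  apply/esym; rewrite -subTset => x _.
  have [m _ Fm] : (\bigcup_n F n) (x ord0) by rewrite -FT.
  have [n _ Gn] : (\bigcup_n G n) (unconsp d x).2 by rewrite -GT.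
  exists (maxn m n) => //; split => /=.
    by apply: (subsetPset _ _ (ndF _ _ (leq_maxl m n))).
  by apply: (subsetPset _ _ (ndG _ _ (leq_maxr m n))).
move=> n; have [mF Fn] := Foo n; have [mG Gn] := Goo n.
split.
  rewrite -[X in measurable X]setTI; apply: measurable_unconsp => //.
  exact: measurableX.
rewrite /cons_measure /pushforward -comp_preimage.
rewrite (_ : _ \o _ = id); last by apply/funext => z; rewrite /= conspK.
by rewrite preimage_id product_measure1E// lte_mul_pinfty// ge0_fin_numE.
Qed.

HB.instance Definition _ :=
  Measure_isSigmaFinite.Build _ _ _ cons_measure sigma_finite_cons_measure.
End cons_measure.

(** The recursion mirrors [iint], so that one use of Tonelli per coordinate identifies the iterated
    integral with an integral against a genuine measure. *)
Fixpoint leb (d : nat) : {sigma_finite_measure set (RdT d) -> \bar R} :=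
  match d with
  | 0 => \d_((fun=> 0) : RdT 0)
  | d'.+1 => cons_measure d' (leb d')
  end.

Lemma ge0_integral_lebS d (f : RdT d.+1 -> \bar R) :
  measurable_fun setT f -> (forall x, 0 <= f x)%E ->
  (\int[leb d.+1]_x f x =
   \int[@lebesgue_measure R]_t \int[leb d]_y f (consRd t y))%E.
Proof.
move=> mf f0; rewrite (@ge0_integral_pushforward _ _ _ _ _ _ (measurable_consp d))//.
rewrite preimage_setT (fubini_tonelli1 (f \o @consp d))//.
  by apply: measurableT_comp => //; exact: measurable_consp.
by move=> z; exact: f0.
Qed.

Lemma measurable_consRd d (t : R) :
  measurable_fun setT (fun y : RdT d => consRd t y : RdT d.+1).
Proof.
apply: measurable_fun_Rd => i; rewrite /consRd.
by case: unliftP => [j|] _; [exact: measurable_coord|exact: measurable_cst].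
Qed.

Lemma iintE d (f : RdT d -> \bar R) :
  measurable_fun setT f -> (forall x, 0 <= f x)%E ->
  (iint f = \int[leb d]_x f x)%E.
Proof.
elim: d f => [|d IH] f mf f0.
  by rewrite integral_dirac//= diracT mul1e.
rewrite ge0_integral_lebS//=; apply: eq_integral => t _; apply: IH => //.
exact: measurableT_comp mf (measurable_consRd d t).
Qed.

Lemma bmeasP d (f : Rd R d -> R) :
  bmeas f <-> measurable_fun setT (f : RdT d -> R).
Proof.
split=> [mf _ B mB|mf B mB].
  by rewrite setTI; exact: mf.
by rewrite -[X in borelRd X]setTI; exact: mf.
Qed.

Lemma sintE d (f : Rd R d -> R) : bmeas f ->
  sint f = (\int[leb d]_x (f x)%:E)%E.
Proof.
move=> /bmeasP mf; rewrite integralE /sint.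
congr (_ - _)%E; rewrite iintE.
- by apply: eq_integral => x _; rewrite funeposE -EFin_max.
- by apply/measurable_EFinP; apply: measurable_maxr.
- by move=> x; rewrite lee_fin le_max lexx orbT.
- by apply: eq_integral => x _; rewrite funenegE -EFinN -EFin_max.
- by apply/measurable_EFinP; apply: measurable_maxr => //; exact: measurable_funN.
- by move=> x; rewrite lee_fin le_max lexx orbT.
Qed.

End LebesgueRd.

Set Implicit Arguments.
Unset Strict Implicit.

(** * A calculus of integrable functions with known integral *)

Section HasIntegral.
Context d (T : measurableType d) (R : realType) (mu : {measure set T -> \bar R}).

(** Bundling integrability with a real value lets linearity, domination and changes of variable be
    chained without extended reals or side conditions. *)
Definition hasint (f : T -> R) (v : R) : Prop :=
  mu.-integrable setT (EFin \o f) /\ (\int[mu]_x (f x)%:E = v%:E)%E.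

Lemma hasint_measurable f v : hasint f v -> measurable_fun setT f.
Proof. by move=> [/measurable_int/measurable_EFinP]. Qed.

Lemma eq_hasint f g v : f =1 g -> hasint f v -> hasint g v.
Proof. by move=> /funext ->. Qed.

Lemma integrable_hasint f : mu.-integrable setT (EFin \o f) ->
  hasint f (fine (\int[mu]_x (f x)%:E)%E).
Proof. by move=> If; split=> //; rewrite fineK//; exact: integrable_fin_num. Qed.

Lemma hasint_uniq f v w : hasint f v -> hasint f w -> v = w.
Proof. by move=> [_ hv] [_]; rewrite hv => -[]. Qed.

Lemma hasintD f g v w : hasint f v -> hasint g w ->
  hasint (fun x => f x + g x) (v + w).
Proof.
move=> [If vE] [Ig wE]; split; first exact: (integrableD _ If Ig).
under eq_integral do rewrite EFinD.
by rewrite (integralD _ If Ig)//= vE wE.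
Qed.

Lemma hasintZ c f v : hasint f v -> hasint (fun x => c * f x) (c * v).
Proof.
move=> [If vE]; split; first exact: (integrableZl _ c If).
under eq_integral do rewrite EFinM.
by rewrite (integralZl _ If)//= vE.
Qed.

Lemma hasintN f v : hasint f v -> hasint (fun x => - f x) (- v).
Proof.
move=> h; rewrite -mulN1r.
by apply: eq_hasint (hasintZ (-1) h) => x; rewrite mulN1r.
Qed.

Lemma hasint0 : hasint (fun=> 0) 0.
Proof. by split; [exact: integrable0|rewrite integral0]. Qed.

Lemma hasint_sum (I : Type) (s : seq I) (f : I -> T -> R) (v : I -> R) :
  (forall i, hasint (f i) (v i)) ->
  hasint (fun x => \sum_(i <- s) f i x) (\sum_(i <- s) v i).
Proof.
move=> h; elim: s => [|i s IH].
  by rewrite big_nil; apply: eq_hasint hasint0 => x; rewrite big_nil.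
rewrite big_cons; apply: eq_hasint (hasintD (h i) IH) => x.
by rewrite big_cons.
Qed.

Lemma hasint_dominated (f g : T -> R) w : measurable_fun setT f -> hasint g w ->
  (forall x, `|f x| <= g x) -> exists2 v, hasint f v & `|v| <= w.
Proof.
move=> mf [Ig wE] fg.
have If : mu.-integrable setT (EFin \o f).
  apply: le_integrable Ig => //; first exact/measurable_EFinP.
  by move=> x _ /=; rewrite lee_fin (le_trans (fg x))// ler_norm.
have hf := integrable_hasint If.
exists (fine (\int[mu]_x (f x)%:E)%E) => //.
rewrite -lee_fin -wE; case: hf => _ hf.
rewrite -abse_EFin -hf; apply: le_trans (le_abse_integral _ _ _) _ => //.
  exact/measurable_EFinP.
apply: ge0_le_integral => //=.
- by apply/measurable_EFinP; apply: measurableT_comp.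
- exact: (measurable_int mu Ig).
- by move=> x _; rewrite lee_fin.
Qed.

Lemma hasint_ge0 f v : hasint f v -> (forall x, 0 <= f x) -> 0 <= v.
Proof.
by move=> [_ fv] f0; rewrite -lee_fin -fv; apply: integral_ge0 => x _; rewrite lee_fin.
Qed.

Lemma hasint_le f g v w : hasint f v -> hasint g w -> (forall x, f x <= g x) -> v <= w.
Proof.
move=> hf hg fg; rewrite -subr_ge0.
apply: (hasint_ge0 (hasintD hg (hasintN hf))) => x /=.
by rewrite subr_ge0.
Qed.

Lemma ge0_hasint (f : T -> R) v : measurable_fun setT f -> (forall x, 0 <= f x) ->
  (\int[mu]_x (f x)%:E = v%:E)%E -> hasint f v.
Proof.
move=> mf f0 fv; split => //; apply/integrableP; split.
  exact/measurable_EFinP.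
under eq_integral do rewrite /= ger0_norm//.
by rewrite fv ltry.
Qed.

End HasIntegral.

Section HasIntegralProduct.
Context d1 d2 (T1 : measurableType d1) (T2 : measurableType d2) (R : realType).
Variable m1 : {sigma_finite_measure set T1 -> \bar R}.
Variable m2 : {sigma_finite_measure set T2 -> \bar R}.

Lemma integrable_prod_meas (F : T1 * T2 -> R) (H : T1 -> R) w :
  measurable_fun setT F ->
  (forall x, hasint m2 (fun y => `|F (x, y)|) (H x)) -> hasint m1 H w ->
  (m1 \x m2)%E.-integrable setT (EFin \o F).
Proof.
move=> mF hH [_ hw]; apply/integrable12ltyP; first exact/measurable_EFinP.
rewrite (_ : (fun x => _) = EFin \o H); first by rewrite hw ltry.
by apply/funext => x /=; have [_ <-] := hH x.
Qed.

(** Fubini as a transfer principle: [H] certifies integrability on the product, and the value of one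
    iterated integral is handed over to the other. *)
Lemma hasint_fubini (F : T1 * T2 -> R) (H G1 : T1 -> R) (G2 : T2 -> R) w v :
  measurable_fun setT F ->
  (forall x, hasint m2 (fun y => `|F (x, y)|) (H x)) -> hasint m1 H w ->
  (forall x, hasint m2 (fun y => F (x, y)) (G1 x)) ->
  (forall y, hasint m1 (fun x => F (x, y)) (G2 y)) ->
  hasint m2 G2 v -> hasint m1 G1 v.
Proof.
move=> mF hH hw hG1 hG2 [_ hv].
have IF := integrable_prod_meas mF hH hw.
have G1E : EFin \o G1 = fubini_F m2 (EFin \o F).
  by apply/funext => x /=; have [_ <-] := hG1 x.
split; first by rewrite G1E; exact: integrable_fubini_F.
transitivity (\int[m1]_x fubini_F m2 (EFin \o F) x)%E; first by rewrite -G1E.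
rewrite (integral12_prod_meas1 IF) -(integral21_prod_meas1 IF) -hv.
by apply: eq_integral => y _; have [_] := hG2 y.
Qed.

End HasIntegralProduct.

Section HasIntegralRd.
Context {R : realType}.
Local Notation RdT d := (g_sigma_algebraType (@rd_gen R d)).
Local Notation lambda := (@lebesgue_measure R).

(** [Rd R 0] has a single point, so every function on it is measurable and integration is
    evaluation; this is the base case of the inductions on dimension. *)
Lemma hasint_leb0 (f : RdT 0 -> R) : hasint (leb 0) f (f (fun=> 0)).
Proof.
have mf : measurable_fun setT f.
  move=> _ B _; rewrite setTI.
  have [->|/set0P[x Bx]] := eqVneq (f @^-1` B) set0; first exact: measurable0.
  rewrite (_ : _ @^-1` _ = setT)//; apply/seteqP; split => // y _ /=.
  by rewrite (_ : y = x)//; apply/funext => -[].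
have mfE : measurable_fun setT (EFin \o f) by exact/measurable_EFinP.
split.
  apply/integrableP; split => //.
  rewrite integral_dirac//= ?diracT ?mul1e ?ltry//.
  by apply/measurable_EFinP; apply: measurableT_comp.
by rewrite integral_dirac//= diracT mul1e.
Qed.

Lemma ge0_hasint_lebS d (F : RdT d.+1 -> R) (G : R -> R) v :
  measurable_fun setT F -> (forall x, 0 <= F x) ->
  (forall t, hasint (leb d) (fun y => F (consRd t y)) (G t)) ->
  hasint lambda G v -> hasint (leb d.+1) F v.
Proof.
move=> mF F0 hG [_ hv]; apply: ge0_hasint => //.
rewrite ge0_integral_lebS//; last exact/measurable_EFinP.
by rewrite -hv; apply: eq_integral => t _; have [_ <-] := hG t.
Qed.

Lemma hasint_lebS d (F : RdT d.+1 -> R) (G : R -> R) v :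
  (leb d.+1).-integrable setT (EFin \o F) ->
  (forall t, hasint (leb d) (fun y => F (consRd t y)) (G t)) ->
  hasint lambda G v -> hasint (leb d.+1) F v.
Proof.
move=> IF hG [_ hv]; split=> //.
have mF : measurable_fun setT (EFin \o F) by exact: measurable_int IF.
have IFc : (lambda \x leb d)%E.-integrable setT ((EFin \o F) \o @consp R d).
  apply/integrableP; split.
    by apply: measurableT_comp => //; exact: measurable_consp.
  have /integrableP[_] := IF; rewrite ge0_integral_lebS//.
    rewrite (fubini_tonelli1 (fun z => `|((EFin \o F) \o @consp R d) z|)%E)//.
    apply: measurableT_comp => //; apply: measurableT_comp => //.
    exact: measurable_consp.
  exact: measurableT_comp.
rewrite (@integral_pushforward _ _ _ _ _ _ (measurable_consp d) _ _ _ mF IFc)//.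
rewrite preimage_setT -(integral12_prod_meas1 IFc) -hv.
by apply: eq_integral => t _; have [_ <-] := hG t.
Qed.

End HasIntegralRd.

(** * Changes of variable and symmetry on the line *)

Section OneDim.
Context {R : realType}.
Local Notation lambda := (@lebesgue_measure R).

Lemma ge0_hasintN (f : R -> R) v : measurable_fun setT f -> (forall x, 0 <= f x) ->
  hasint lambda f v -> hasint lambda (fun t => f (- t)) v.
Proof.
move=> mf f0 [_ hv].
have mN : measurable_fun setT (-%R : measurableTypeR R -> measurableTypeR R).
  by apply: measurable_funN; exact: measurable_id.
apply: ge0_hasint => //; first exact: measurableT_comp mf mN.
rewrite -hv; transitivity (\int[pushforward lambda (-%R : _ -> measurableTypeR R)]_x (f x)%:E)%E.
  rewrite (@ge0_integral_pushforward _ _ _ _ _ _ mN) ?preimage_setT//.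
  - exact/measurable_EFinP.
  - by move=> x _; rewrite lee_fin.
by apply: eq_measure_integral => A mA _; exact: lebesgue_measureN.
Qed.

(** The left side is a measure that gives half-open intervals their length, and uniqueness of
    Lebesgue measure does the rest. *)
Lemma lebesgue_measure_affine (c r : R) (A : set R) : 0 < c -> measurable A ->
  (c%:E * pushforward lambda ((fun t => (c * t + r)%R) : measurableTypeR R -> measurableTypeR R) A = lambda A)%E.
Proof.
move=> c0 mA.
have mphi : measurable_fun setT ((fun t => c * t + r) : measurableTypeR R -> measurableTypeR R).
  by apply: measurable_funD => //; exact: measurable_funM.
pose mu := mscale (NngNum (ltW c0))
  (measure_function_pushforward__canonical__measure_function_Measure lambda mphi).
apply/esym; rewrite (@lebesgue_measure_unique R mu)// => _ [[a b]] _ <-.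
pose I : set R := `](a - r) / c, (b - r) / c]%classic.
transitivity (c%:E * lambda I)%E; last first.
  apply: (congr1 (fun B => c%:E * lambda B)%E).
  apply/funext => x; apply/propext; rewrite /I /= !in_itv/=.
  by rewrite ltr_pdivrMr// ler_pdivlMr// ltrBlDr lerBrDr mulrC.
rewrite /I !lebesgue_measure_itv/= !lte_fin ltr_pM2r ?invr_gt0// ltrD2r.
case: ifP => _; last by rewrite mule0.
by rewrite -!EFinD -EFinM; congr EFin; field; rewrite gt_eqF.
Qed.

Lemma ge0_hasint_affine (f : R -> R) c r v : 0 < c ->
  measurable_fun setT f -> (forall x, 0 <= f x) ->
  hasint lambda f v -> hasint lambda (fun t => f (c * t + r)) (c^-1 * v).
Proof.
move=> c0 mf f0 [_ hv].
pose phi : measurableTypeR R -> measurableTypeR R := fun t => c * t + r.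
have mphi : measurable_fun setT phi.
  by apply: measurable_funD => //; exact: measurable_funM.
have mfE : measurable_fun setT (EFin \o f) by exact/measurable_EFinP.
apply: ge0_hasint => //; first exact: measurableT_comp mf mphi.
pose pf := measure_function_pushforward__canonical__measure_function_Measure lambda mphi.
have E : (\int[pf]_x (f x)%:E = \int[lambda]_x (f (phi x))%:E)%E.
  rewrite (@ge0_integral_pushforward _ _ _ _ _ _ mphi) ?preimage_setT//.
  by move=> x _; rewrite lee_fin.
rewrite -E EFinM -hv.
have -> : (\int[lambda]_x (f x)%:E = \int[mscale (NngNum (ltW c0)) pf]_x (f x)%:E)%E.
  apply: eq_measure_integral => A mA _; apply/esym.
  exact: (lebesgue_measure_affine r c0 mA).
rewrite ge0_integral_mscale//=; last by move=> x _; rewrite lee_fin.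
by rewrite muleA -EFinM mulVf ?gt_eqF// mul1e.
Qed.

Lemma funrposBnegE (f : R -> R) x : f^\+ x - f^\- x = f x.
Proof. exact: (congr1 (fun h => h x) (funrposBneg f)). Qed.

Lemma hasint_posneg (f : R -> R) v : hasint lambda f v ->
  exists v1 v2, [/\ hasint lambda f^\+ v1, hasint lambda f^\- v2 & v = v1 - v2].
Proof.
move=> hf; have mf := hasint_measurable hf.
have ha : hasint lambda (fun x => `|f x|) (fine (\int[lambda]_x `|f x|%:E)%E).
  by apply: integrable_hasint; case: hf => /integrable_norm.
have [|v1 h1 _] := @hasint_dominated _ _ _ lambda f^\+ _ _ (measurable_funrpos mf) ha.
  by move=> x; rewrite ger0_norm ?funrpos_ge0// /funrpos ge_max ler_norm normr_ge0.
have [|v2 h2 _] := @hasint_dominated _ _ _ lambda f^\- _ _ (measurable_funrneg mf) ha.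
  by move=> x; rewrite ger0_norm ?funrneg_ge0// /funrneg ge_max -normrN ler_norm normr_ge0.
exists v1, v2; split => //; apply: (hasint_uniq hf).
by apply: eq_hasint (hasintD h1 (hasintN h2)) => x; rewrite /= funrposBnegE.
Qed.

Lemma hasint_reflect (f : R -> R) v :
  hasint lambda f v -> hasint lambda (fun t => f (- t)) v.
Proof.
move=> hf; have mf := hasint_measurable hf.
have [v1 [v2 [h1 h2 ->]]] := hasint_posneg hf.
have {}h1 := ge0_hasintN (measurable_funrpos mf) (funrpos_ge0 f) h1.
have {}h2 := ge0_hasintN (measurable_funrneg mf) (funrneg_ge0 f) h2.
by apply: eq_hasint (hasintD h1 (hasintN h2)) => x; rewrite /= funrposBnegE.
Qed.

Lemma hasint_affine (f : R -> R) c r v : 0 < c ->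
  hasint lambda f v -> hasint lambda (fun t => f (c * t + r)) (c^-1 * v).
Proof.
move=> c0 hf; have mf := hasint_measurable hf.
have [v1 [v2 [h1 h2 ->]]] := hasint_posneg hf.
have {}h1 := ge0_hasint_affine r c0 (measurable_funrpos mf) (funrpos_ge0 f) h1.
have {}h2 := ge0_hasint_affine r c0 (measurable_funrneg mf) (funrneg_ge0 f) h2.
rewrite mulrBr.
by apply: eq_hasint (hasintD h1 (hasintN h2)) => x; rewrite /= funrposBnegE.
Qed.

Lemma hasint_odd (f : R -> R) v : hasint lambda f v ->
  (forall t, f (- t) = - f t) -> v = 0.
Proof.
move=> hf fN; have h : v = - v.
  apply: (hasint_uniq (hasint_reflect hf)).
  by apply: eq_hasint (hasintN hf) => t; rewrite fN.
by apply/eqP; rewrite -[_ == _](mulrn_eq0 v 2) mulr2n {1}h addNr.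
Qed.

Lemma measurable_cosM (a b : R) : measurable_fun setT (fun t : R => cos (a + b * t)).
Proof.
apply: measurableT_comp; first exact: continuous_measurable_fun (@continuous_cos R).
by apply: measurable_funD => //; exact: measurable_funM.
Qed.

Lemma measurable_sinM (b : R) : measurable_fun setT (fun t : R => sin (b * t)).
Proof.
apply: measurableT_comp; first exact: continuous_measurable_fun (@continuous_sin R).
exact: measurable_funM.
Qed.


(** For even [f] the sine half of the addition formula integrates to zero by oddness. This allows
    real cosine transforms with a phase in place of complex exponentials. *)
Lemma hasint_phase (f : R -> R) w v (b s : R) : hasint lambda (fun t => `|f t|) w ->
  measurable_fun setT f -> (forall t, f (- t) = f t) ->
  hasint lambda (fun t => f t * cos (b * t)) v ->
  hasint lambda (fun t => f t * cos (s + b * t)) (cos s * v).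
Proof.
move=> hw mf fN hv.
have [||u hu _] := @hasint_dominated _ _ _ lambda (fun t => f t * sin (b * t)) _ _ _ hw.
- by apply: measurable_funM => //; exact: measurable_sinM.
- by move=> x; rewrite normrM ler_piMr// sin_max.
have u0 : u = 0 by apply: (hasint_odd hu) => t; rewrite fN mulrN sinN mulrN.
rewrite u0 in hu.
rewrite -[_ * v]addr0 -[0](mulr0 (- sin s)).
apply: eq_hasint (hasintD (hasintZ (cos s) hv) (hasintZ (- sin s) hu)) => t /=.
by rewrite cosD; ring.
Qed.

Lemma hasint_indic (E : set (measurableTypeR R)) (f : R -> R) v : measurable E ->
  lambda.-integrable E (EFin \o f) -> (\int[lambda]_(x in E) (f x)%:E = v%:E)%E ->
  hasint lambda (fun x => \1_E x * f x) v.
Proof.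
move=> mE If hv.
have fE : EFin \o (fun x => \1_E x * f x) = patch (fun=> 0%E) E (EFin \o f).
  apply/funext => x; rewrite patchE /= indicE.
  by case: ifP => _; rewrite ?mul1r ?mul0r.
split; first by rewrite fE; apply: (proj1 (integrable_mkcond _ mE) If).
by rewrite -hv [RHS]integral_mkcond -fE.
Qed.

Lemma hasint_FTC2 (a b : R) (f F : R -> R) : a < b -> continuous f ->
  (forall x : R, is_derive x 1 F (f x)) ->
  hasint lambda (fun x => \1_(`[a, b]%classic) x * f x) (F b - F a) /\
  hasint lambda (fun x => \1_(`]a, b]%classic) x * f x) (F b - F a).
Proof.
move=> ab cf dF.
have If : lambda.-integrable `[a, b]%classic (EFin \o f).
  apply: continuous_compact_integrable; first exact: segment_compact.
  exact: continuous_subspaceT.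
have hv : (\int[lambda]_(x in `[a, b]%classic) (f x)%:E = (F b - F a)%:E)%E.
  rewrite (@continuous_FTC2 _ f F)//.
  - exact: continuous_subspaceT.
  - split.
    + by move=> x _; case: (dF x).
    + apply: cvg_at_right_filter.
      by apply: differentiable_continuous; apply/derivable1_diffP; case: (dF a).
    + apply: cvg_at_left_filter.
      by apply: differentiable_continuous; apply/derivable1_diffP; case: (dF b).
  - by move=> x _; rewrite derive1E; case: (dF x).
split; apply: hasint_indic => //.
- by apply: integrableS If => //; exact: subset_itv_oc_cc.
- rewrite integral_itv_obnd_cbnd//.
  apply/measurable_EFinP; apply: measurable_funTS.
  exact: continuous_measurable_fun.
Qed.

End OneDim.

(** * The Fejer kernel and the triangle function *)

Section Fejer.
Context {R : realType}.
Local Notation lambda := (@lebesgue_measure R).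

(** The value 1/2 at 0 is the continuous extension, which keeps the transform formulas below valid
    at every point. *)
Definition fejer (t : R) : R := if t == 0 then 2^-1 else (1 - cos t) / t ^+ 2.
Definition tri (u : R) : R := Num.max (1 - `|u|) 0.

Lemma fejerN t : fejer (- t) = fejer t.
Proof. by rewrite /fejer oppr_eq0 cosN sqrrN. Qed.

Lemma fejer_ge0 t : 0 <= fejer t.
Proof.
rewrite /fejer; case: eqP => _; first by rewrite invr_ge0.
by rewrite divr_ge0 ?sqr_ge0// subr_ge0 cos_le1.
Qed.

Lemma tri_ge0 u : 0 <= tri u. Proof. by rewrite /tri le_max lexx orbT. Qed.

Lemma triN u : tri (- u) = tri u. Proof. by rewrite /tri normrN. Qed.

Lemma tri_eq0 u : 1 <= `|u| -> tri u = 0.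
Proof. by move=> u1; apply/max_idPr; rewrite subr_le0. Qed.

Lemma tri_le1 u : tri u <= 1.
Proof. by rewrite /tri ge_max ler01 andbT gerBl. Qed.

Lemma measurable_tri : measurable_fun setT tri.
Proof.
by apply: measurable_maxr => //; apply: measurable_funB.
Qed.

Lemma measurable_fejer : measurable_fun setT fejer.
Proof.
apply: measurable_fun_ifT => //.
  by apply: (measurable_fun_eqr (f := id)).
apply: measurable_funM.
  apply: measurable_funB => //.
  exact: continuous_measurable_fun (@continuous_cos R).
rewrite (_ : (fun t => _) = (fun t : R => (t ^+ 2) `^ (-1))); last first.
  by apply/funext => t; rewrite powR_inv1// sqr_ge0.
apply: (measurableT_comp (measurable_powR _)).
by apply: measurable_funX.
Qed.

Lemma is_derive_sinM (t u : R) :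
  is_derive u (1 : R) (fun u => sin (t * u)) (t * cos (t * u)).
Proof.
have h : is_derive u (1 : R) (fun u => t * u) t.
  by apply: is_derive_eq; rewrite !scaler1 //.
have := is_derive1_comp (is_derive_sin (t * u)) h.
by rewrite mulrC.
Qed.

Lemma is_derive_cosM (t u : R) :
  is_derive u (1 : R) (fun u => cos (t * u)) (- (t * sin (t * u))).
Proof.
have h : is_derive u (1 : R) (fun u => t * u) t.
  by apply: is_derive_eq; rewrite !scaler1 //.
have := is_derive1_comp (is_derive_cos (t * u)) h.
by rewrite mulNr mulrC.
Qed.

Lemma ftc_tri_cos (t : R) : exists2 F : R -> R,
  (forall u : R, is_derive u 1 F ((1 - u) * cos (t * u))) & F 1 - F 0 = fejer t.
Proof.
rewrite /fejer; case: eqVneq => [->|t0].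
  exists (fun u => u - 2^-1 * u ^+ 2) => [u|]; last by field.
  rewrite mul0r cos0 mulr1.
  apply: is_derive_eq; rewrite /GRing.scale /=. by field.
exists (fun u => (1 - u) * (t^-1 * sin (t * u)) - t ^- 2 * cos (t * u)) => [u|].
  have := is_derive_sinM t u; have := is_derive_cosM t u => h1 h2.
  apply: is_derive_eq; rewrite /GRing.scale /=.
  by field.
by rewrite mulr1 mulr0 sin0 cos0; field.
Qed.

(** The Fourier transform of the triangle. Since [tri] is the weight of a probability density, the
    bounds [fejer_le] and [fejer_near0] follow by estimating the cosine under the integral. *)
Lemma hasint_tri_cos (t : R) :
  hasint lambda (fun u => tri u * cos (t * u)) (2 * fejer t).
Proof.
have [F dF <-] := ftc_tri_cos t.
have cf : continuous (fun u : R => (1 - u) * cos (t * u)).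
  move=> u; apply: cvgM.
    by apply: cvgB; [exact: cvg_cst|exact: cvg_id].
  apply: continuous_comp; last exact: continuous_cos.
  by apply: cvgM; [exact: cvg_cst|exact: cvg_id].
have [h1 h2] := hasint_FTC2 ltr01 cf dF.
rewrite mulr_natl mulr2n.
apply: eq_hasint (hasintD (hasint_reflect h1) h2) => u.
rewrite /= mulrN cosN !indicE /tri.
have [u0|u0] := ltP 0 u.
  rewrite memNset ?mul0r ?add0r; last by rewrite /= in_itv/= oppr_ge0 leNgt u0.
  rewrite gtr0_norm//; have [u1|u1] := leP u 1.
    by rewrite mem_set ?mul1r ?max_l ?subr_ge0//= in_itv/= u0.
  rewrite memNset ?mul0r ?max_r ?mul0r ?subr_le0 ?(ltW u1)//=.
  by rewrite in_itv/= u0 leNgt u1.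
rewrite [u \in _]memNset ?mul0r ?addr0; last by rewrite /= in_itv/= ltNge u0.
rewrite ler0_norm//; have [u1|u1] := leP (- u) 1.
  by rewrite mem_set ?mul1r ?max_l ?subr_ge0//= in_itv/= oppr_ge0 u0.
rewrite memNset ?mul0r ?max_r ?mul0r ?subr_le0 ?(ltW u1)//=.
by rewrite in_itv/= oppr_ge0 u0 leNgt u1.
Qed.

Lemma hasint_tri : hasint lambda tri 1.
Proof.
have := hasint_tri_cos 0; rewrite /fejer eqxx mulfV//.
by apply: eq_hasint => u; rewrite mul0r cos0 mulr1.
Qed.

Lemma fejer_le t : fejer t <= 2^-1.
Proof.
suff : 2 * fejer t <= 1 by rewrite -ler_pdivlMl// mulr1.
apply: (hasint_le (hasint_tri_cos t) hasint_tri) => u.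
by rewrite ler_piMr ?tri_ge0 ?cos_le1.
Qed.

Lemma fejer_near0 t : `|t| <= 1 -> cos 1 / 2 <= fejer t.
Proof.
move=> t1; suff : cos 1 * 1 <= 2 * fejer t by lra.
apply: (hasint_le (hasintZ (cos 1) hasint_tri) (hasint_tri_cos t)) => u.
have [u1|u1] := leP 1 `|u|; first by rewrite tri_eq0// mulr0 mul0r.
rewrite mulrC ler_wpM2l ?tri_ge0//.
rewrite -(cos_norm (t * u)) normrM.
have tu1 : `|t| * `|u| <= 1 by rewrite mulr_ile1 ?normr_ge0 ?t1 ?(ltW u1).
have pi1 : 1 <= pi :> R by have := @pi_ge2 R; lra.
have tu0 : 0 <= `|t| * `|u| by rewrite mulr_ge0.
by rewrite leNgt ltr_cos ?in_itv/= -?leNgt ?tu0 ?ler01 ?(le_trans tu1).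
Qed.

Lemma fejer_decay t : fejer t * t ^+ 2 <= 2.
Proof.
rewrite /fejer; case: eqVneq => [->|t0]; first by rewrite expr0n/= mulr0.
by rewrite divfK ?expf_neq0//; have := cos_geN1 t; lra.
Qed.

Lemma hasint_fejer_ex : exists K, hasint lambda fejer K.
Proof.
have oneDsqr_ge0 (x : R) : 0 <= oneDsqr x by rewrite (le_trans ler01)// oneDsqr_ge1.
have h : lambda.-integrable setT (EFin \o (fun t : R => (oneDsqr t)^-1)).
  apply/integrableP; split.
    by apply/measurable_EFinP; exact: continuous_measurable_fun (@continuous_oneDsqrV R).
  under eq_integral do rewrite /= ger0_norm ?invr_ge0 ?oneDsqr_ge0//.
  rewrite ge0_symfun_integralT.
  - rewrite -set_itvcy integral0y_oneDsqr.
    by rewrite -EFinM ltry.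
  - by move=> x; rewrite invr_ge0 oneDsqr_ge0.
  - exact: continuous_oneDsqrV.
  - by move=> x /=; rewrite /oneDsqr sqrrN.
(* 5/2 = 1/2 + 2 adds the bounds for [fejer t] and for [fejer t * t ^+ 2], so that [fejer] lies
   below 5/2 times 1/(1 + t^2). *)
have [|v hv _] := @hasint_dominated _ _ _ lambda fejer _ _ measurable_fejer (hasintZ (5 / 2) (integrable_hasint h)).
  move=> t; rewrite ger0_norm ?fejer_ge0//.
  have p : 0 < oneDsqr t by rewrite (lt_le_trans ltr01)// oneDsqr_ge1.
  rewrite ler_pdivlMr// /oneDsqr mulrDr mulr1.
  by have := fejer_le t; have := fejer_decay t; lra.
by exists v.
Qed.

End Fejer.

(** * Cosine transforms of modulated Fejer kernels *)

Section FejerFourier.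
Context {R : realType}.
Local Notation lambda := (@lebesgue_measure R).

Variable K : R.
Hypothesis hK : hasint lambda (@fejer R) K.

Lemma hasint_sqr_fejer (c : R) :
  hasint lambda (fun t => c ^+ 2 * fejer (c * t)) (K * `|c|).
Proof.
have [->|c0] := eqVneq c 0.
  rewrite normr0 mulr0; apply: eq_hasint (hasint0 _) => t.
  by rewrite expr0n/= mul0r.
have pos e : 0 < e -> hasint lambda (fun t => e ^+ 2 * fejer (e * t)) (K * e).
  move=> e0; have := hasintZ (e ^+ 2) (hasint_affine 0 e0 hK).
  rewrite (_ : e ^+ 2 * (e^-1 * K) = K * e); last by field; rewrite gt_eqF.
  by apply: eq_hasint => t; rewrite addr0.
have := pos `|c|; rewrite normr_gt0 => /(_ c0); apply: eq_hasint => t.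
rewrite real_normK ?num_real//; congr (_ * _).
by have [_|_] := ger0P c => //; rewrite mulNr fejerN.
Qed.

Lemma sqr_fejerE (c t : R) : t != 0 -> c ^+ 2 * fejer (c * t) = (1 - cos (c * t)) / t ^+ 2.
Proof.
move=> t0; rewrite /fejer mulf_eq0 (negbTE t0) orbF.
have [->|c0] := eqVneq c 0; first by rewrite expr0n/= !mul0r cos0 subrr mul0r.
by rewrite exprMn; field; rewrite c0 t0.
Qed.

(** The product-to-sum formula writes a modulated kernel as a combination of rescaled kernels, whose
    integrals are K times an absolute value by [hasint_sqr_fejer]. This computes the transform
    without a Fourier inversion theorem. *)
Lemma fejer_prod_cos (a xi t : R) :
  a ^+ 2 * fejer (a * t) * cos (xi * t) =
  2^-1 * ((a + xi) ^+ 2 * fejer ((a + xi) * t)) +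
  (2^-1 * ((a - xi) ^+ 2 * fejer ((a - xi) * t)) +
   - (xi ^+ 2 * fejer (xi * t))).
Proof.
have [->|t0] := eqVneq t 0.
  by rewrite !mulr0 cos0 /fejer eqxx; field.
rewrite !sqr_fejerE// [(a + xi) * t]mulrDl [(a - xi) * t]mulrBl cosD cosB.
by field.
Qed.

Lemma triE (u : R) : tri u = 2^-1 * `|1 + u| + 2^-1 * `|1 - u| - `|u|.
Proof.
rewrite /tri; wlog u0 : u / 0 <= u => [hw|].
  have [/hw//|/ltW u0] := leP 0 u.
  have := hw (- u); rewrite oppr_ge0 => /(_ u0).
  by rewrite normrN opprK => ->; congr (_ - _); rewrite addrC.
rewrite (ger0_norm u0) [`|1 + u|]ger0_norm ?addr_ge0//.
have [u1|/ltW u1] := leP u 1.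
  by rewrite ger0_norm ?subr_ge0// max_l ?subr_ge0//; field.
by rewrite ler0_norm ?subr_le0// max_r ?subr_le0//; field.
Qed.

(** The second difference of the absolute value left by [fejer_prod_cos] is a triangle, by
    [triE]. *)
Lemma hasint_fejer_cos (a xi : R) : 0 < a ->
  hasint lambda (fun t => fejer (a * t) * cos (xi * t)) (K / a * tri (xi / a)).
Proof.
move=> a0; have an0 : a != 0 by rewrite gt_eqF.
have h := hasintD (hasintZ 2^-1 (hasint_sqr_fejer (a + xi)))
  (hasintD (hasintZ 2^-1 (hasint_sqr_fejer (a - xi)))
    (hasintN (hasint_sqr_fejer xi))).
have := hasintZ (a ^- 2) h.
rewrite (_ : _ * _ = K / a * tri (xi / a)).
  by apply: eq_hasint => t; rewrite -fejer_prod_cos; field.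
rewrite triE.
have E (x : R) : `|x| = a * `|x / a| by rewrite normf_div (gtr0_norm a0); field.
rewrite (E (a + xi)) (E (a - xi)) (E xi) mulrDl mulrBl mulfV//.
by field.
Qed.

(** [a] is a bandwidth and [b] a carrier frequency: the transform [khat] consists of two triangles
    of half-width [a] centred at [b] and [-b]. *)
Definition kap (a b t : R) : R := fejer (a * t) * cos (b * t).
Definition khat (a b xi : R) : R :=
  K / (2 * a) * (tri ((xi + b) / a) + tri ((xi - b) / a)).

Lemma kapN a b t : kap a b (- t) = kap a b t.
Proof. by rewrite /kap !mulrN fejerN cosN. Qed.

Lemma khatN a b xi : khat a b (- xi) = khat a b xi.
Proof.
rewrite /khat addrC; congr (_ * (_ + _)).
  by rewrite -opprD mulNr triN.
by rewrite addrC -[b - xi]opprB mulNr triN.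
Qed.

Lemma measurable_kap a b : measurable_fun setT (kap a b).
Proof.
apply: measurable_funM.
  apply: (measurableT_comp measurable_fejer); exact: measurable_funM.
apply: measurableT_comp; first exact: continuous_measurable_fun (@continuous_cos R).
exact: measurable_funM.
Qed.

Lemma kap_le a b t : `|kap a b t| <= fejer (a * t).
Proof. by rewrite /kap normrM ger0_norm ?fejer_ge0// ler_piMr ?fejer_ge0 ?cos_max. Qed.

Lemma hasint_fejerM a : 0 < a -> hasint lambda (fun t => fejer (a * t)) (K / a).
Proof.
move=> a0; rewrite mulrC; apply: eq_hasint (hasint_affine 0 a0 hK) => t.
by rewrite addr0.
Qed.

Lemma hasint_abs_kap a b : 0 < a ->
  exists2 w, hasint lambda (fun t => `|kap a b t|) w & w <= K / a.
Proof.
move=> a0; have [||w hw ww] := @hasint_dominated _ _ _ lambda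
  (fun t => `|kap a b t|) _ _ _ (hasint_fejerM a0).
- by apply: measurableT_comp => //; exact: measurable_kap.
- by move=> x; rewrite normr_id kap_le.
by exists w => //; rewrite (le_trans _ ww)// ler_norm.
Qed.

Lemma hasint_kap_cos a b xi : 0 < a ->
  hasint lambda (fun t => kap a b t * cos (xi * t)) (khat a b xi).
Proof.
move=> a0; have h := hasintZ 2^-1 (hasintD (hasint_fejer_cos (xi + b) a0)
  (hasint_fejer_cos (xi - b) a0)).
have an0 : a != 0 by rewrite gt_eqF.
rewrite (_ : khat a b xi = 2^-1 * (K / a * tri ((xi + b) / a) +
  K / a * tri ((xi - b) / a))); last by rewrite /khat; field.
apply: eq_hasint h => t; rewrite /kap [(xi + b) * t]mulrDl [(xi - b) * t]mulrBl cosD cosB.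
by field.
Qed.

Lemma hasint_abs_tri : hasint lambda (fun u => `|tri u|) 1.
Proof. by apply: (eq_hasint _ (@hasint_tri R)) => u; rewrite ger0_norm ?tri_ge0. Qed.

Lemma hasint_tri_shift a b t : 0 < a ->
  hasint lambda (fun xi => tri ((xi + b) / a) * cos (t * xi))
    (a * cos (b * t) * (2 * fejer (a * t))).
Proof.
move=> a0; have an0 : a != 0 by rewrite gt_eqF.
have hp := @hasint_phase R tri _ _ (a * t) (- (b * t)) hasint_abs_tri
  measurable_tri triN (hasint_tri_cos (a * t)).
have ia : 0 < a^-1 by rewrite invr_gt0.
have := hasint_affine (b / a) ia hp.
rewrite invrK cosN (mulrA a); apply: eq_hasint => xi.
rewrite (_ : a^-1 * xi + b / a = (xi + b) / a); last by field.
by congr (_ * cos _); field.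
Qed.

(** Fourier inversion for this pair, obtained by transforming the two triangles; 2K stands where 2
    pi is usually found. *)
Lemma hasint_khat_cos a b t : 0 < a ->
  hasint lambda (fun xi => khat a b xi * cos (t * xi)) (2 * K * kap a b t).
Proof.
move=> a0; have an0 : a != 0 by rewrite gt_eqF.
have := hasintZ (K / (2 * a)) (hasintD (hasint_tri_shift b t a0)
  (hasint_tri_shift (- b) t a0)).
rewrite (_ : _ * (_ + _) = 2 * K * kap a b t).
  by apply: eq_hasint => xi; rewrite /khat; ring.
by rewrite /kap mulNr cosN; field.
Qed.

Lemma measurable_khat a b : measurable_fun setT (khat a b).
Proof.
apply: measurable_funM => //; apply: measurable_funD.
  apply: (measurableT_comp measurable_tri); apply: measurable_funM => //.
  exact: measurable_funD.
apply: (measurableT_comp measurable_tri); apply: measurable_funM => //.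
exact: measurable_funB.
Qed.

Lemma hasint_abs_khat a b : 0 < a ->
  exists w, hasint lambda (fun t => `|khat a b t|) w.
Proof.
move=> a0.
have ia : 0 < a^-1 by rewrite invr_gt0.
have h := hasintZ `|K / (2 * a)| (hasintD (hasint_affine (b / a) ia (@hasint_tri R))
  (hasint_affine (- b / a) ia (@hasint_tri R))).
eexists; apply: eq_hasint h => xi.
have E c : a^-1 * xi + c / a = (xi + c) / a by rewrite mulrDl mulrC.
by rewrite /khat [RHS]normrM !E [X in _ = _ * X]ger0_norm ?addr_ge0 ?tri_ge0.
Qed.

Lemma khat_eq0 a b xi : 0 < a -> 0 <= b -> a <= `| `|xi| - b| -> khat a b xi = 0.
Proof.
move=> a0 b0; wlog xi0 : xi / 0 <= xi => [hw h|].
  have [/hw/(_ h)//|/ltW xi0] := leP 0 xi.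
  by rewrite -khatN hw ?oppr_ge0// normrN.
rewrite (ger0_norm xi0) => h; rewrite /khat !tri_eq0 ?addr0 ?mulr0//.
  by rewrite normf_div (gtr0_norm a0) ler_pdivlMr// mul1r.
rewrite normf_div (gtr0_norm a0) ler_pdivlMr// mul1r.
rewrite (le_trans h)// [leRHS]ger0_norm ?addr_ge0// ler_norml.
by apply/andP; split; lra.
Qed.

End FejerFourier.

(** * Tensor products and their cosine transforms *)

Section Tensor.
Context {R : realType}.
Local Notation RdT d := (g_sigma_algebraType (@rd_gen R d)).
Local Notation lambda := (@lebesgue_measure R).

(** A tensor product of integrable functions as majorant supplies the absolute integrability that
    [hasint_fubini] asks for. *)
Lemma hasint_fubini_dominated d1 d2 (T1 : measurableType d1) (T2 : measurableType d2)
    (m1 : {sigma_finite_measure set T1 -> \bar R})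
    (m2 : {sigma_finite_measure set T2 -> \bar R})
    (F : T1 * T2 -> R) (g1 : T1 -> R) (g2 : T2 -> R) (G1 : T1 -> R) (G2 : T2 -> R)
    w1 w2 v :
  measurable_fun setT F -> (forall z, `|F z| <= g1 z.1 * g2 z.2) ->
  (forall x, 0 <= g1 x) -> (forall y, 0 <= g2 y) ->
  hasint m1 g1 w1 -> hasint m2 g2 w2 ->
  (forall x, hasint m2 (fun y => F (x, y)) (G1 x)) ->
  (forall y, hasint m1 (fun x => F (x, y)) (G2 y)) ->
  hasint m2 G2 v -> hasint m1 G1 v.
Proof.
move=> mF Fg g10 g20 h1 h2 hG1 hG2 hv.
pose H x := fine (\int[m2]_y `|F (x, y)|%:E)%E.
have hH x : hasint m2 (fun y => `|F (x, y)|) (H x).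
  apply: integrable_hasint.
  by have [/integrable_norm] := hG1 x.
have Hle x : H x <= g1 x * w2.
  by apply: (hasint_le (hH x) (hasintZ (g1 x) h2)) => y; exact: Fg (x, y).
have H0 x : 0 <= H x by apply: (hasint_ge0 (hH x)) => y.
have mH : measurable_fun setT H.
  apply: (measurableT_comp (fine_measurable measurableT)).
  apply: (measurable_fun_fubini_tonelli_F (fun z => `|F z|%:E)).
    by apply/measurable_EFinP; apply: measurableT_comp.
  by move=> z; rewrite lee_fin.
have [|w hw _] := @hasint_dominated _ _ _ m1 H _ _ mH (hasintZ w2 h1).
  by move=> x; rewrite ger0_norm// mulrC.
exact: (hasint_fubini mF hH hw hG1 hG2 hv).
Qed.

Lemma measurable_prod_coord d (f : 'I_d -> R -> R) :
  (forall i, measurable_fun setT (f i)) ->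
  measurable_fun setT (fun y : RdT d => \prod_(i < d) f i (y i)).
Proof.
move=> mf; apply: measurable_prod => i _.
exact: measurableT_comp (mf i) (measurable_coord i).
Qed.

Lemma measurable_dot d (xi : Rd R d) :
  measurable_fun setT (fun y : RdT d => dotRd y xi).
Proof.
apply: measurable_sum => i.
by apply: measurable_funM => //; exact: measurable_coord.
Qed.

Lemma measurable_cosD_dot d (a : R) (xi : Rd R d) :
  measurable_fun setT (fun y : RdT d => cos (a + dotRd y xi)).
Proof.
apply: measurableT_comp; first exact: continuous_measurable_fun (@continuous_cos R).
by apply: measurable_funD => //; exact: measurable_dot.
Qed.

Lemma prod_consRd d (f : 'I_d.+1 -> R -> R) t (y : Rd R d) :
  \prod_(i < d.+1) f i (consRd t y i) =
  f ord0 t * \prod_(i < d) f (lift ord0 i) (y i).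
Proof.
rewrite big_ord_recl consRd0; congr (_ * _).
by apply: eq_bigr => i _; rewrite consRdS.
Qed.

Lemma dot_consRd d t (y : Rd R d) (xi : Rd R d.+1) :
  dotRd (consRd t y) xi = xi ord0 * t + dotRd y (fun i => xi (lift ord0 i)).
Proof.
rewrite /dotRd big_ord_recl consRd0 mulrC; congr (_ + _).
by apply: eq_bigr => i _; rewrite consRdS.
Qed.

Lemma hasint_tensor_abs d (f : 'I_d -> R -> R) (w : 'I_d -> R) :
  (forall i, measurable_fun setT (f i)) ->
  (forall i, hasint lambda (fun t => `|f i t|) (w i)) ->
  hasint (leb d) (fun y => `|\prod_(i < d) f i (y i)|) (\prod_(i < d) w i).
Proof.
elim: d f w => [|d IH] f w mf hw.
  rewrite big_ord0; apply: eq_hasint (hasint_leb0 (fun=> 1)) => y.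
  by rewrite big_ord0 normr1.
have {}IH := IH (fun i => f (lift ord0 i)) (fun i => w (lift ord0 i))
  (fun i => mf _) (fun i => hw _).
have hv : hasint lambda (fun t => `|f ord0 t| * \prod_(i < d) w (lift ord0 i))
    (\prod_(i < d.+1) w i).
  rewrite big_ord_recl mulrC.
  by apply: eq_hasint (hasintZ _ (hw ord0)) => t; rewrite mulrC.
have ht t : hasint (leb d) (fun y => `|\prod_(i < d.+1) f i (consRd t y i)|)
    (`|f ord0 t| * \prod_(i < d) w (lift ord0 i)).
  by apply: eq_hasint (hasintZ `|f ord0 t| IH) => y; rewrite prod_consRd normrM.
apply: (ge0_hasint_lebS _ _ ht hv) => //.
by apply: measurableT_comp => //; exact: measurable_prod_coord.
Qed.

(** The phase [a] makes the induction go through: peeling off the coordinate [ord0] adds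
    [xi ord0 * t] to it. The hypothesis on each factor expresses symmetry about [r i], as
    [hasint_phase] provides. *)
Lemma hasint_tensor_cos d (f : 'I_d -> R -> R) (w v : 'I_d -> R) (r xi : Rd R d) a :
  (forall i, measurable_fun setT (f i)) ->
  (forall i, hasint lambda (fun t => `|f i t|) (w i)) ->
  (forall i s, hasint lambda (fun t => f i t * cos (s + xi i * t))
    (cos (s + xi i * r i) * v i)) ->
  hasint (leb d) (fun y => \prod_(i < d) f i (y i) * cos (a + dotRd y xi))
    (cos (a + dotRd r xi) * \prod_(i < d) v i).
Proof.
elim: d f w v r xi a => [|d IH] f w v r xi a mf hw hv.
  rewrite /dotRd !big_ord0 addr0 mulr1.
  apply: eq_hasint (hasint_leb0 (fun=> cos a)) => y.
  by rewrite !big_ord0 addr0 mul1r.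
pose r' : Rd R d := fun i => r (lift ord0 i).
pose xi' : Rd R d := fun i => xi (lift ord0 i).
have {}IH s := IH (fun i => f (lift ord0 i)) (fun i => w (lift ord0 i))
  (fun i => v (lift ord0 i)) r' xi' s (fun i => mf _) (fun i => hw _) (fun i => hv _).
have mF : measurable_fun setT
    (fun y : RdT d.+1 => \prod_(i < d.+1) f i (y i) * cos (a + dotRd y xi)).
  by apply: measurable_funM; [exact: measurable_prod_coord|exact: measurable_cosD_dot].
have FE t (y : Rd R d) :
    \prod_(i < d.+1) f i (consRd t y i) * cos (a + dotRd (consRd t y) xi) =
    f ord0 t * (\prod_(i < d) f (lift ord0 i) (y i) *
      cos ((a + xi ord0 * t) + dotRd y xi')).
  by rewrite prod_consRd dot_consRd -mulrA addrA.
have [|u [iu _] _] := @hasint_dominated _ _ _ (leb d.+1) _ _ _ mF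
    (hasint_tensor_abs mf hw).
  by move=> y; rewrite normrM ler_piMr// cos_max.
pose G t := f ord0 t * (cos (a + xi ord0 * t + dotRd r' xi') *
  \prod_(i < d) v (lift ord0 i)).
apply: (hasint_lebS iu (G := G)) => [t|].
  by apply: eq_hasint (hasintZ (f ord0 t) (IH (a + xi ord0 * t))) => y; rewrite FE.
have := hasintZ (\prod_(i < d) v (lift ord0 i)) (hv ord0 (a + dotRd r' xi')).
rewrite (_ : _ * _ = cos (a + dotRd r xi) * \prod_(i < d.+1) v i).
  apply: eq_hasint => t; rewrite /G (_ : a + dotRd r' xi' + xi ord0 * t =
    a + xi ord0 * t + dotRd r' xi'); first by ring.
  by rewrite addrAC.
rewrite big_ord_recl /dotRd big_ord_recl mulrC -mulrA; congr (cos _ * _).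
by rewrite [r ord0 * _]mulrC addrAC addrA.
Qed.

End Tensor.

(** * Continuous functions on R^d: measurability and integrability *)

Section ContinuousRd.
Context {R : realType}.
Local Notation RdT d := (g_sigma_algebraType (@rd_gen R d)).
Local Notation lambda := (@lebesgue_measure R).

Lemma measurable_box d (c : Rd R d) (e : R) :
  measurable ([set y | forall i, `|y i - c i| < e] : set (RdT d)).
Proof.
rewrite (_ : [set y | _] = \bigcap_(i in [set: 'I_d]) [set y | `|y i - c i| < e]).
  apply: fin_bigcap_measurable => // i _.
  rewrite -[X in measurable X]setTI.
  apply: (measurable_fun_ltr _ _ measurableT) => //.
  apply: measurableT_comp => //; apply: measurable_funB => //.
  exact: measurable_coord.
by apply/seteqP; split => [y h i _|y h i]; [exact: h|exact: (h i I)].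
Qed.

(** The preimage of an open half-line is a countable union of boxes with rational centres and radii
    1/(n+1); boxes are measurable since only coordinates generate the sigma-algebra. *)
Lemma contRd_measurable d (g : Rd R d -> R) : contRd g -> bmeas g.
Proof.
move=> cg; apply/bmeasP.
apply: (measurability _ (RGenOInfty.measurableE R)) => //= _ [_ [a ->] <-].
rewrite setTI.
pose box (u : {ffun 'I_d -> rat} * nat) : set (RdT d) :=
  [set y | forall i, `|y i - ratr (u.1 i)| < u.2.+1%:R^-1].
pose F u := if `[< box u `<=` g @^-1` `]a, +oo[ >] then box u else set0.
rewrite (_ : _ @^-1` _ = \bigcup_u F u).
  apply: countable_bigcupT_measurable => // u; rewrite /F.
  by case: asboolP => _; [exact: measurable_box|exact: measurable0].
apply/seteqP; split => [x|x [u _]]; last first.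
  by rewrite /F; case: asboolP => // h /h.
rewrite /= in_itv/= andbT => agx.
have ga0 : 0 < g x - a by rewrite subr_gt0.
have [dl dl0 hdl] := cg x _ ga0.
(* Two radii must fit below [dl]: one from x to the rational centre, one from the centre to y. *)
have [n hn] : exists n : nat, n.+1%:R^-1 + n.+1%:R^-1 < dl.
  have dl2 : 0 < dl / 2 by rewrite divr_gt0.
  have [n] := ltr_add_invr dl2.
  by rewrite add0r => h; exists n; rewrite (splitr dl) ltrD.
have n0 : (0 : R) < n.+1%:R^-1 by rewrite invr_gt0.
have [r rE] : {r : R | r = n.+1%:R^-1} by exists n.+1%:R^-1.
rewrite -rE in n0 hn.
have hc i : {c : rat | `|x i - ratr c| < r}.
  have lt_x : x i - r < x i + r by lra.
  apply: cid; have [c hc] := rat_in_itvoo lt_x; exists c.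
  by move: hc; rewrite in_itv/= ltr_norml => /andP[? ?]; apply/andP; split; lra.
pose c := [ffun i => sval (hc i)].
exists (c, n) => //; rewrite /F; case: asboolP => [_ i|].
  by rewrite /= ffunE -rE; exact: svalP (hc i).
case=> y hy; rewrite /= in_itv/= andbT.
have : `|g y - g x| < g x - a.
  apply: hdl => i; have := hy i; have := svalP (hc i); rewrite /= ffunE -rE.
  move: (sval _) => ci; rewrite !ltr_norml => /andP[? ?] /andP[? ?].
  by apply/andP; split; lra.
by rewrite ltr_norml => /andP[? ?]; lra.
Qed.

(** Compactness of the cube of half-side M, after passing to row vectors, which carry a topology. *)
Lemma contRd_bounded d (g : Rd R d -> R) (M : R) : contRd g ->
  (forall x i, M < `|x i| -> g x = 0) -> exists B, forall x, `|g x| <= B.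
Proof.
move=> cg g0.
pose h (v : 'rV[R]_d) := g (fun i => v ord0 i).
have ch : continuous h.
  move=> v A /nbhs_ballP[e /= e0 hA].
  have [dl dl0 hdl] := cg (fun i => v ord0 i) e e0.
  suff : nbhs v (h @^-1` A) by [].
  apply/nbhs_ballP; exists dl => //= w [_ hw]; apply: hA.
  rewrite /ball/= distrC; apply: (hdl (fun i => w ord0 i)) => i; rewrite distrC; exact: hw ord0 i.
pose A := [set v : 'rV[R]_d | forall i, `[- M, M]%classic (v ord0 i)].
have cA : compact A.
  by apply: (@rV_compact R d (fun=> `[- M, M]%classic)) => i; exact: segment_compact.
have [B [_ hB]] : bounded_set (h @` A).
  apply: (@compact_bounded _ R^o); apply: continuous_compact => //.
  exact: continuous_subspaceT.
exists (`|B| + 1) => x.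
have [/forallP xM|] := boolP [forall i, `|x i| <= M].
  apply: (hB (`|B| + 1)); first by rewrite (le_lt_trans (ler_norm B))// ltrDl.
  exists (\row_i x i).
    by move=> i /=; rewrite mxE in_itv/= -ler_norml.
  by rewrite /h; congr g; apply/funext => i; rewrite mxE.
rewrite negb_forall => /existsP[i]; rewrite -ltNge => /g0 ->.
by rewrite normr0 addr_ge0.
Qed.

Lemma coord_le_enorm d (x : Rd R d) i : `|x i| <= enorm x.
Proof.
rewrite -sqrtr_sqr /enorm ler_wsqrtr// (bigD1 i)//= lerDl.
by apply: sumr_ge0 => j _; exact: sqr_ge0.
Qed.

Lemma hasint_contRd d (g : Rd R d -> R) (M : R) : 0 < M -> contRd g ->
  (forall x, M <= enorm x -> g x = 0) ->
  exists w, hasint (leb d) (fun x => `|g x|) w.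
Proof.
move=> M0 cg g0.
have g0' x i : M < `|x i| -> g x = 0.
  by move=> h; apply: g0; rewrite (le_trans (ltW h))// coord_le_enorm.
have [B hB] := contRd_bounded cg g0'.
have B0 : 0 <= B by rewrite (le_trans _ (hB (fun=> 0))).
pose I : R -> R := \1_(`[- M, M]%classic).
have iI : lambda.-integrable setT (EFin \o I) by exact: integrable_indic_itv.
have mI : measurable_fun setT I by apply/measurable_EFinP; exact: measurable_int iI.
have hI : hasint lambda (fun t => `|I t|) (fine (\int[lambda]_t `|I t|%:E)%E).
  by apply: integrable_hasint; exact: integrable_norm.
have := hasint_tensor_abs (fun i : 'I_d => mI) (fun=> hI) => /(hasintZ B) hT.
have [||w hw _] := @hasint_dominated _ _ _ _ (fun x : RdT d => `|g x|) _ _ _ hT.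
- apply: measurableT_comp => //; apply/bmeasP; exact: contRd_measurable.
- move=> x; rewrite normr_id.
  have [/forallP xM|] := boolP [forall i, `|x i| <= M].
    rewrite big1 ?normr1 ?mulr1// => i _.
    by rewrite /I indicE mem_set//= in_itv/= -ler_norml.
  rewrite negb_forall => /existsP[i]; rewrite -ltNge => /g0' ->.
  by rewrite normr0 mulr_ge0.
by exists w.
Qed.

Lemma contRd_scale d (g : Rd R d -> R) (c : R) : contRd g ->
  contRd (fun x => g (scaleRd c x)).
Proof.
move=> cg x e e0; have [dl dl0 h] := cg (scaleRd c x) e e0.
have c0 : 0 < `|c| + 1 by rewrite ltr_wpDl.
exists (dl / (`|c| + 1)) => [|y hy]; first by rewrite divr_gt0.
apply: h => i; rewrite /scaleRd -mulrBr normrM.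
have := hy i; rewrite ltr_pdivlMr// => h; apply: le_lt_trans h.
by rewrite mulrC ler_wpM2l// lerDl.
Qed.

Lemma enorm_scale d (c : R) (x : Rd R d) : enorm (scaleRd c x) = `|c| * enorm x.
Proof.
rewrite /enorm /scaleRd; under eq_bigr do rewrite exprMn.
by rewrite -mulr_sumr sqrtrM ?sqr_ge0// sqrtr_sqr.
Qed.

Lemma contRdB d (g h : Rd R d -> R) : contRd g -> contRd h ->
  contRd (fun x => g x - h x).
Proof.
move=> cg ch x e e0; have e2 : 0 < e / 2 by rewrite divr_gt0.
have [d1 d10 h1] := cg x _ e2; have [d2 d20 h2] := ch x _ e2.
exists (Num.min d1 d2) => [|y hy]; first by rewrite lt_min d10.
have := h1 y (fun i => _); have := h2 y (fun i => _).
have hy1 i : `|y i - x i| < d1 by have := hy i; rewrite lt_min => /andP[].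
have hy2 i : `|y i - x i| < d2 by have := hy i; rewrite lt_min => /andP[].
move=> /(_ hy2) + /(_ hy1); rewrite !ltr_norml => /andP[? ?] /andP[? ?].
by apply/andP; split; lra.
Qed.

End ContinuousRd.

(** * The dyadic partition of unity on thin annuli *)

Section Annuli.
Context {R : realType} (d : nat) (phi0 : Rd R d -> R).
Hypothesis phi0P : is_phi0 phi0.
Local Notation RdT d := (g_sigma_algebraType (@rd_gen R d)).

Let cphi0 : contRd phi0.
Proof. by have [/(_ [::])[]] := phi0P. Qed.

Lemma contRd_phik k : contRd (phik phi0 k).
Proof. by case: k => [//|k]; apply: contRdB; exact: contRd_scale. Qed.

Lemma measurable_phik k : measurable_fun setT (phik phi0 k : RdT d -> R).
Proof. by apply: (proj1 (bmeasP _ _)); exact: contRd_measurable (contRd_phik k). Qed.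

Lemma scale_exp2 k (x : Rd R d) : enorm (scaleRd (2 ^- k) x) = enorm x / 2 ^+ k.
Proof. by rewrite enorm_scale ger0_norm ?invr_ge0 ?exprn_ge0// mulrC. Qed.

Lemma phik_eq0 k x : 3 / 2 * 2 ^+ k <= enorm x -> phik phi0 k x = 0.
Proof.
have [_ _ h0] := phi0P; case: k => [|k] /= h.
  by apply: h0; rewrite expr0 mulr1 in h.
rewrite !h0 ?subrr//; rewrite scale_exp2 ler_pdivlMr ?exprn_gt0//.
rewrite (le_trans _ h)// ler_pM2l// exprS ler_peMl ?exprn_ge0//.
by rewrite ler1n.
Qed.

Lemma hasint_abs_phik k : exists w, hasint (leb d) (fun x => `|phik phi0 k x|) w.
Proof.
apply: (hasint_contRd _ (contRd_phik k) (phik_eq0 (k := k))).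
by rewrite mulr_gt0// exprn_gt0.
Qed.

(** On this annulus the rescaled [phi0 (scaleRd (2 ^- n) x)] is 1 for n >= j and 0 for n < j,
    because 3/4 * 2 = 3/2. The differences [phik] telescope to a Kronecker delta. *)
Lemma phik_annulus (j k : nat) (x : Rd R d) :
  3 / 4 * 2 ^+ j <= enorm x -> enorm x <= 2 ^+ j ->
  phik phi0 k x = (k == j)%:R.
Proof.
have [_ h1 h0] := phi0P => hl hu.
have p2 n : (0 : R) < 2 ^+ n by rewrite exprn_gt0.
have lo n : (j <= n)%N -> phi0 (scaleRd (2 ^- n) x) = 1.
  move=> jn; apply: h1; rewrite scale_exp2 ler_pdivrMr// mul1r (le_trans hu)//.
  by rewrite ler_weXn2l// ler1n.
have hi n : (n < j)%N -> phi0 (scaleRd (2 ^- n) x) = 0.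
  move=> nj; apply: h0; rewrite scale_exp2 ler_pdivlMr// (le_trans _ hl)//.
  have -> : 3 / 2 * 2 ^+ n = 3 / 4 * 2 ^+ n.+1 :> R by rewrite exprS; field.
  by rewrite ler_pM2l// ler_weXn2l// ler1n.
case: k => [|k] /=.
  have -> : phi0 x = phi0 (scaleRd (2 ^- 0) x).
    by congr phi0; apply/funext => i; rewrite /scaleRd expr0 invr1 mul1r.
  case: (posnP j) => [j0|j0]; first by rewrite lo j0.
  by rewrite hi// eq_sym gtn_eqF.
case: (ltngtP k.+1 j) => [kj|jk|jk].
- by rewrite !hi ?subrr// ltnW.
- by rewrite !lo ?subrr// ltnW.
- by rewrite lo ?jk// hi -?jk// subr0.
Qed.

End Annuli.

(** * Spikes and their Littlewood-Paley pieces *)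

Section Spikes.
Context {R : realType} (n : nat).
Local Notation d := n.+1.
Local Notation RdT d := (g_sigma_algebraType (@rd_gen R d)).
Local Notation lambda := (@lebesgue_measure R).

Variable K : R.
Hypothesis hK : hasint lambda (@fejer R) K.

(** With the carrier 17/20 along one axis in [freq], a bandwidth 1/(10d) in units of 2^j keeps the
    frequency support inside the annulus of [phik_annulus]: 17/20 - 1/10 = 3/4, and (17/20 + 1/10)^2
    + 1/100 < 1. *)
Definition width (j : nat) : R := (10 * d%:R)^-1 * 2 ^+ j.
Definition freq (j : nat) (i : 'I_d) : R := (if i == ord0 then 17 / 20 else 0) * 2 ^+ j.

(** Only the coordinate [ord0] is modulated; the other factors are plain Fejer kernels. *)
Definition eta (j : nat) (r x : Rd R d) : R :=
  \prod_(i < d) kap (width j) (freq j i) (x i - r i).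
Definition etah (j : nat) (xi : Rd R d) : R :=
  \prod_(i < d) khat K (width j) (freq j i) (xi i).

Lemma width_gt0 j : 0 < width j.
Proof. by rewrite mulr_gt0 ?invr_gt0 ?mulr_gt0 ?exprn_gt0// ltr0n. Qed.

Lemma freq_ge0 j i : 0 <= freq j i.
Proof. by rewrite mulr_ge0 ?exprn_ge0//; case: ifP. Qed.

Lemma etah_annulus j xi : etah j xi != 0 ->
  3 / 4 * 2 ^+ j <= enorm xi /\ enorm xi <= 2 ^+ j.
Proof.
move=> /prodf_neq0 h.
have {}h i : `| `|xi i| - freq j i| < width j.
  rewrite ltNge; apply/negP => /(khat_eq0 K (width_gt0 j) (freq_ge0 j i)) h0.
  by have := h i isT; rewrite h0 eqxx.
have p2 : (0 : R) < 2 ^+ j by rewrite exprn_gt0.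
pose e : R := (10 * d%:R)^-1.
have d1 : (1 : R) <= d%:R by rewrite ler1n.
have e0 : 0 < e by rewrite invr_gt0 mulr_gt0// ltr0n.
have ed : e * d%:R = 10^-1 by rewrite /e invfM mulfVK// pnatr_eq0.
have e10 : e <= 10^-1 by rewrite -ed ler_peMr// ltW.
split.
  apply: le_trans (coord_le_enorm xi ord0).
  have := h ord0; rewrite /freq eqxx /width -/e ltr_norml => /andP[+ _].
  have : e * 2 ^+ j <= 10^-1 * 2 ^+ j by rewrite ler_pM2r.
  by lra.
rewrite -[leRHS]gtr0_norm// -sqrtr_sqr /enorm ler_wsqrtr//.
have hi i : xi i ^+ 2 <= ((if i == ord0 then 17 / 20 else 0) + e) ^+ 2 * (2 ^+ j) ^+ 2.
  rewrite -exprMn -ler_sqrt ?sqr_ge0// !sqrtr_sqr.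
  rewrite [leRHS]ger0_norm; last first.
    apply: mulr_ge0; last exact: ltW.
    by apply: addr_ge0; [case: ifP|exact: ltW].
  have := ltr_normlW (h i); rewrite /freq /width -/e ltrBlDr => /ltW hi.
  by rewrite mulrDl addrC.
apply: le_trans (ler_sum _ (fun i _ => hi i)) _.
rewrite -mulr_suml ler_piMl ?sqr_ge0// big_ord_recl eqxx.
under eq_bigr do rewrite add0r.
rewrite sumr_const card_ord -mulr_natr.
have : n%:R * e <= 10^-1.
  by rewrite -ed mulrC ler_pM2l// ler_nat.
have : (0 : R) <= n%:R by rewrite ler0n.
move: (n%:R) => m m0 me.
have : e ^+ 2 * m <= 100^-1.
  rewrite expr2 -mulrA (mulrC e m); have -> : 100^-1 = 10^-1 * 10^-1 :> R by field.
  by rewrite ler_pM// ?mulr_ge0// ltW.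
by nra.
Qed.

Lemma measurable_eta j r : measurable_fun setT (eta j r : RdT d -> R).
Proof.
apply: (measurable_prod_coord (f := fun i t => kap (width j) (freq j i) (t - r i))) => i.
by apply: (measurableT_comp (measurable_kap _ _)); exact: measurable_funB.
Qed.

Lemma hasint_abs_eta j r : exists2 w,
  hasint (leb d) (fun x => `|eta j r x|) w & w <= (K / width j) ^+ d.
Proof.
have hw i := hasint_abs_kap hK (freq j i) (width_gt0 j).
pose w i := sval (cid2 (hw i)).
have hw1 i : hasint lambda (fun t => `|kap (width j) (freq j i) (t - r i)|) (w i).
  have := hasint_affine (- r i) ltr01 (s2valP (cid2 (hw i))).
  by rewrite invr1 mul1r; apply: eq_hasint => t; rewrite mul1r.
exists (\prod_(i < d) w i).
  apply: (hasint_tensor_abs (f := fun i t => kap (width j) (freq j i) (t - r i))) => // i.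
  by apply: (measurableT_comp (measurable_kap _ _)); exact: measurable_funB.
rewrite -[d in leRHS]card_ord -prodr_const; apply: ler_prod => i _.
rewrite (s2valP' (cid2 (hw i))) andbT.
by apply: (hasint_ge0 (hw1 i)) => t.
Qed.

Lemma hasint_eta_cos j r xi a :
  hasint (leb d) (fun y => eta j r y * cos (a + dotRd y xi))
    (cos (a + dotRd r xi) * etah j xi).
Proof.
have hw i := hasint_abs_kap hK (freq j i) (width_gt0 j).
pose w i := sval (cid2 (hw i)).
have hw1 i : hasint lambda (fun t => `|kap (width j) (freq j i) (t - r i)|) (w i).
  have := hasint_affine (- r i) ltr01 (s2valP (cid2 (hw i))).
  by rewrite invr1 mul1r; apply: eq_hasint => t; rewrite mul1r.
apply: (hasint_tensor_cos (f := fun i t => kap (width j) (freq j i) (t - r i)) (w := w)) => //.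
  by move=> i; apply: (measurableT_comp (measurable_kap _ _)); exact: measurable_funB.
move=> i s.
have hp := hasint_phase (s + xi i * r i) (s2valP (cid2 (hw i)))
  (measurable_kap _ _) (@kapN _ _ _) (hasint_kap_cos hK (freq j i) (xi i) (width_gt0 j)).
have := hasint_affine (- r i) ltr01 hp.
rewrite invr1 mul1r; apply: eq_hasint => t; rewrite mul1r.
by congr (_ * cos _); ring.
Qed.

Lemma hasint_etah_cos j (x : Rd R d) a :
  hasint (leb d) (fun xi => etah j xi * cos (a + dotRd xi x))
    (cos a * \prod_(i < d) (2 * K * kap (width j) (freq j i) (x i))).
Proof.
have hw i := hasint_abs_khat K (freq j i) (width_gt0 j).
pose w i := sval (cid (hw i)).
have := @hasint_tensor_cos _ _ (fun i => khat K (width j) (freq j i)) w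
  (fun i => 2 * K * kap (width j) (freq j i) (x i)) (fun=> 0) x a.
have -> : dotRd (fun=> 0) x = 0 by rewrite /dotRd big1// => i _; rewrite mul0r.
rewrite addr0; apply.
- by move=> i; exact: measurable_khat.
- by move=> i; exact: svalP (cid (hw i)).
move=> i s; rewrite mulr0 addr0.
exact: (hasint_phase s (svalP (cid (hw i))) (measurable_khat _ _ _) (@khatN _ _ _ _)
  (hasint_khat_cos K (freq j i) (x i) (width_gt0 j))).
Qed.

Variable phi0 : Rd R d -> R.
Hypothesis phi0P : is_phi0 phi0.

Lemma phik_etah k j xi : phik phi0 k xi * etah j xi = (k == j)%:R * etah j xi.
Proof.
have [->|/etah_annulus[h1 h2]] := eqVneq (etah j xi) 0; first by rewrite !mulr0.
by rewrite (phik_annulus phi0P k h1 h2).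
Qed.

Definition spike (N : nat) (r : Rd R d) (c : R) (x : Rd R d) : R :=
  c * \sum_(j < N) eta j r x.

Lemma measurable_spike N r c : measurable_fun setT (spike N r c : RdT d -> R).
Proof.
apply: measurable_funM => //; apply: measurable_sum => j.
exact: measurable_eta.
Qed.

(** The phase treats both parts of the convolution kernel at once: a = 0 gives [psic] and a = -pi/2
    gives [psis], up to the factor (2 pi)^-d. *)
Definition psia (a : R) (k : nat) (z : Rd R d) : R :=
  fine (sint (fun xi => phik phi0 k xi * cos (a + dotRd z xi))).

Lemma dotRdC (x y : Rd R d) : dotRd x y = dotRd y x.
Proof. by apply: eq_bigr => i _; rewrite mulrC. Qed.

Lemma hasint_psia a k z :
  hasint (leb d) (fun xi => phik phi0 k xi * cos (a + dotRd z xi)) (psia a k z).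
Proof.
have mf : measurable_fun setT (fun xi : RdT d => phik phi0 k xi * cos (a + dotRd z xi)).
  apply: measurable_funM; first exact: measurable_phik.
  rewrite (_ : (fun xi => cos _) = (fun xi : RdT d => cos (a + dotRd xi z))).
    exact: measurable_cosD_dot.
  by apply/funext => xi; rewrite dotRdC.
have [w hw] := hasint_abs_phik phi0P k.
have [|v hv _] := @hasint_dominated _ _ _ _ _ _ _ mf hw.
  by move=> x; rewrite normrM ler_piMr// cos_max.
rewrite /psia sintE; last exact/bmeasP.
by have [_ ->] := hv.
Qed.

(** Exchanging the integrals puts the transform of the spike against [phik]; the multiplier keeps
    only scale k, and transforming back returns [eta k]. *)
Lemma hasint_spike_psia N r c a k x :
  hasint (leb d) (fun y => spike N r c y * psia a k (subRd x y))
    (c * ((k < N)%N%:R * (cos a * ((2 * K) ^+ d * eta k r x)))).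
Proof.
have dotB (y z xi : Rd R d) : dotRd (subRd y z) xi = dotRd y xi - dotRd z xi.
  by rewrite /dotRd -sumrB; apply: eq_bigr => i _; rewrite mulrBl.
have habs : exists w, hasint (leb d) (fun y => `|spike N r c y|) w.
  have h j := hasint_abs_eta j r.
  have hs := hasintZ `|c| (hasint_sum (index_enum 'I_N)
    (fun j : 'I_N => s2valP (cid2 (h j)))).
  have [||w hw _] := @hasint_dominated _ _ _ (leb d) (fun y => `|spike N r c y|) _ _ _ hs.
  - by apply: measurableT_comp => //; exact: measurable_spike.
  - by move=> y; rewrite normr_id normrM ler_wpM2l// ler_norm_sum.
  by exists w.
have [w1 h1] := habs; have [w2 h2] := hasint_abs_phik phi0P k.
pose F (z : RdT d * RdT d) : R :=
  spike N r c z.1 * (phik phi0 k z.2 * cos (a + dotRd (subRd x z.1) z.2)).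
have mF : measurable_fun setT F.
  apply: measurable_funM.
    exact: (measurableT_comp (measurable_spike N r c) measurable_fst).
  apply: measurable_funM.
    exact: (measurableT_comp (measurable_phik phi0P k) measurable_snd).
  apply: measurableT_comp; first exact: continuous_measurable_fun (@continuous_cos R).
  apply: measurable_funD => //; apply: measurable_sum => i.
  apply: measurable_funM.
    apply: measurable_funB => //.
    exact: (measurableT_comp (measurable_coord i) measurable_fst).
  exact: (measurableT_comp (measurable_coord i) measurable_snd).
pose G2 (xi : RdT d) := phik phi0 k xi *
  (c * \sum_(j < N) (cos (- (a + dotRd x xi) + dotRd r xi) * etah j xi)).
apply: (hasint_fubini_dominated (m1 := leb d) (m2 := leb d) mF (g1 := fun y => `|spike N r c y|)
  (g2 := fun xi => `|phik phi0 k xi|) _ _ _ h1 h2 _ _ (G2 := G2)) => //.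
- by move=> z; rewrite !normrM ler_wpM2l// ler_piMr// cos_max.
- by move=> y; apply: eq_hasint (hasintZ (spike N r c y) (hasint_psia a k (subRd x y))) => xi.
- move=> xi.
  have := hasintZ (phik phi0 k xi) (hasintZ c (hasint_sum (index_enum 'I_N)
    (fun j : 'I_N => hasint_eta_cos j r xi (- (a + dotRd x xi))))).
  apply: eq_hasint => y; rewrite /F /= dotB /spike -mulr_suml.
  rewrite (_ : - (a + dotRd x xi) + dotRd y xi = - (a + (dotRd x xi - dotRd y xi))).
    by rewrite cosN; ring.
  by ring.
have := hasintZ c (hasintZ (k < N)%N%:R (hasint_etah_cos k (subRd x r) a)).
rewrite big_split/= prodr_const card_ord.
apply: eq_hasint => xi; rewrite /G2 -mulr_sumr.
have -> : cos (a + dotRd xi (subRd x r)) = cos (- (a + dotRd x xi) + dotRd r xi).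
  by rewrite [dotRd xi _]dotRdC dotB -cosN; congr cos; ring.
(* Disjoint annuli: the multiplier is 1 on the support of [etah k] and 0 on those of the other
   scales. *)
have sumE : phik phi0 k xi * \sum_(j < N) etah j xi = (k < N)%N%:R * etah k xi.
  rewrite mulr_sumr; under eq_bigr do rewrite phik_etah.
  case: ltnP => kN; last first.
    rewrite mul0r big1// => j _; rewrite gtn_eqF ?mul0r//.
    exact: leq_trans (ltn_ord j) kN.
  rewrite mul1r (bigD1 (Ordinal kN))//= eqxx mul1r big1 ?addr0// => j.
  by rewrite -val_eqE /= eq_sym => /negbTE ->; rewrite mul0r.
set C := cos _; transitivity (c * (C * (phik phi0 k xi * \sum_(j < N) etah j xi))).
  by rewrite sumE; ring.
by ring.
Qed.

(** The imaginary part carries the factor cos(-pi/2) = 0, so the modulus is the absolute value of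
    the real part. *)
Lemma LPpiece_spike N r c k x : LPpiece phi0 k (spike N r c) x =
  `| ((pi *+ 2) ^- d * (2 * K) ^+ d) * c * ((k < N)%N%:R * eta k r x) |.
Proof.
have val a (psi : Rd R d -> R) : psi =1 (fun z => (pi *+ 2) ^- d * psia a k z) ->
    fine (sint (fun y => spike N r c y * psi (subRd x y))) =
    (pi *+ 2) ^- d * (c * ((k < N)%N%:R * (cos a * ((2 * K) ^+ d * eta k r x)))).
  move=> psiE.
  have h : hasint (leb d) (fun y : RdT d => spike N r c y * psi (subRd x y))
      ((pi *+ 2) ^- d * (c * ((k < N)%N%:R * (cos a * ((2 * K) ^+ d * eta k r x))))).
    apply: eq_hasint (hasintZ ((pi *+ 2) ^- d) (hasint_spike_psia N r c a k x)) => y.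
    by rewrite psiE mulrCA.
  rewrite sintE; last by apply: (proj2 (bmeasP _ _)); exact: hasint_measurable h.
  by case: h => _ ->.
rewrite /LPpiece (val 0 (psic phi0 k)); last first.
  by move=> z; rewrite /psic /psia; under [in RHS]eq_fun do rewrite add0r.
rewrite (val (- (pi / 2)) (psis phi0 k)); last first.
  move=> z; rewrite /psis /psia.
  by under [in RHS]eq_fun do rewrite addrC cosBpihalf.
rewrite cosN cos_pihalf cos0 !(mul0r, mulr0) expr0n addr0 sqrtr_sqr mul1r.
by congr (`|_|); ring.
Qed.

End Spikes.

(** * Besov norms of spikes *)

Section BesovNorm.
Context {R : realType}.
Local Notation RdT d := (g_sigma_algebraType (@rd_gen R d)).
Local Notation lambda := (@lebesgue_measure R).

Lemma powR_le_self (x Q : R) : 0 <= x <= 1 -> 1 <= Q -> x `^ Q <= x.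
Proof.
move=> /andP[x0 x1] Q1; have [->|x_neq0] := eqVneq x 0.
  by rewrite powR0// gt_eqF// (lt_le_trans ltr01).
by apply: ge1r_powR; rewrite // lt0r x_neq0 x0.
Qed.

(** Since e^P <= e for e in [0, 1], the L^1 norm of [e] controls its L^P norm; with [e] the modulus
    of [eta k], this yields the sharp exponent d/P from L^1 bounds alone. *)
Lemma Lpn_le d (P : R) (h e : Rd R d -> R) (C w : R) : 1 <= P -> bmeas h -> 0 <= C ->
  (forall x, `|h x| <= C * e x) -> (forall x, 0 <= e x <= 1) ->
  hasint (leb d) e w -> (Lpn P%:E h <= (C * w `^ P^-1)%:E)%E.
Proof.
move=> P1 /bmeasP mh C0 he e01 hw.
have P0 : 0 < P by rewrite (lt_le_trans ltr01).
have w0 : 0 <= w by apply: (hasint_ge0 hw) => x; case/andP: (e01 x).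
have mhP : measurable_fun setT (fun x : RdT d => `|h x| `^ P).
  by apply: (measurableT_comp (measurable_powR P)); exact: measurableT_comp.
have CeE x : (C * e x) `^ P <= C `^ P * e x.
  have /andP[e0 e1] := e01 x.
  by rewrite powRM// ler_wpM2l ?powR_ge0// powR_le_self// e0.
have hle x : `|h x| `^ P <= C `^ P * e x.
  apply: le_trans (CeE x); apply: ge0_ler_powR; rewrite ?nnegrE ?(ltW P0)//.
  by rewrite mulr_ge0//; case/andP: (e01 x).
have [|v hv vle] := @hasint_dominated _ _ _ (leb d) _ _ _ mhP (hasintZ (C `^ P) hw).
  by move=> x; rewrite ger0_norm ?powR_ge0.
have v0 : 0 <= v by apply: (hasint_ge0 hv) => x; exact: powR_ge0.
rewrite /Lpn /= iintE; last 2 first.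
- exact/measurable_EFinP.
- by move=> x; rewrite lee_fin powR_ge0.
have [_ ->] := hv; rewrite poweR_EFin lee_fin.
rewrite (_ : C * _ = (C `^ P * w) `^ P^-1); last first.
  by rewrite powRM ?powR_ge0// -powRrM mulfV ?gt_eqF// powRr1.
apply: ge0_ler_powR; rewrite ?nnegrE ?invr_ge0 ?(ltW P0) ?mulr_ge0 ?powR_ge0//.
by rewrite (le_trans (ler_norm v)).
Qed.

End BesovNorm.

Section SpikeBesov.
Context {R : realType} (n : nat).
Local Notation d := n.+1.
Local Notation RdT d := (g_sigma_algebraType (@rd_gen R d)).
Local Notation lambda := (@lebesgue_measure R).

Variable K : R.
Hypothesis hK : hasint lambda (@fejer R) K.
Variable phi0 : Rd R d -> R.
Hypothesis phi0P : is_phi0 phi0.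

Let K0 : 0 <= K. Proof. by apply: (hasint_ge0 hK) => t; exact: fejer_ge0. Qed.

Definition mass : R := (K * (10 * d%:R)) ^+ d.

Lemma mass_ge0 : 0 <= mass.
Proof. by rewrite exprn_ge0// !mulr_ge0. Qed.

Lemma eta_le1 j (r x : Rd R d) : `|eta j r x| <= 1.
Proof.
rewrite /eta normr_prod; apply: prodr_ile1 => i _ /=.
rewrite normr_ge0 (le_trans (kap_le _ _ _))// (le_trans (fejer_le _))//.
by rewrite invf_le1// ler1n.
Qed.

Lemma hasint_abs_eta_mass j (r : Rd R d) : exists2 w,
  hasint (leb d) (fun x => `|eta j r x|) w & w <= mass * (2 ^+ d) ^- j.
Proof.
have [w hw wle] := hasint_abs_eta hK j r; exists w => //.
rewrite (le_trans wle)// /width invfM invrK mulrA exprMn /mass ler_wpM2l//.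
  by rewrite exprn_ge0// !mulr_ge0.
by rewrite exprVn -!exprM mulnC.
Qed.

Lemma Lpn_spike_lty (P : R) N (r : Rd R d) c : 1 <= P ->
  (Lpn P%:E (spike N r c) < +oo)%E.
Proof.
(* Division by N+1 brings the majorant below 1, as [Lpn_le] requires, and remains meaningful for N =
   0. *)
move=> P1; pose e x := N.+1%:R^-1 * \sum_(j < N) `|eta j r x|.
have h j := hasint_abs_eta_mass j r.
have he := hasintZ N.+1%:R^-1 (hasint_sum (index_enum 'I_N)
  (fun j : 'I_N => s2valP (cid2 (h j)))).
apply: le_lt_trans (ltry _).
apply: (Lpn_le (e := e) (C := `|c| * N.+1%:R) P1 _ _ _ _ he).
- by apply: (proj2 (bmeasP _ _)); exact: measurable_spike.
- by rewrite mulr_ge0.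
- move=> x; rewrite /e mulrA mulfK ?pnatr_eq0// normrM ler_wpM2l//.
  exact: ler_norm_sum.
- move=> x; rewrite mulr_ge0 ?invr_ge0 ?sumr_ge0//=.
  rewrite ler_pdivrMl ?ltr0n// mulr1.
  have : \sum_(j < N) `|eta j r x| <= \sum_(j < N) 1.
    by apply: ler_sum => j _; exact: eta_le1.
  by move/le_trans; apply; rewrite sumr_const card_ord ler_nat.
Qed.

Variables (P s : R).
Hypotheses (P1 : 1 <= P).

(** The growth of the weighted L^P norm from one dyadic scale to the next: below 1 when s < d/P,
    equal to 1 when s = d/P. *)
Definition ratio : R := 2 `^ (s - d%:R / P).

(** The weight 2^(ks) meets the factor 2^(-kd/P), the P-th root of the L^1 bound 2^(-kd). The point
    is that [B] is uniform in the number of scales, the centre, the amplitude and k. *)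
Lemma besov_spike_term : exists2 B : R, 1 <= B & forall N (r : Rd R d) c k, 0 <= c ->
  ((2 `^ (k%:R * s))%:E * Lpn P%:E (LPpiece phi0 k (spike N r c)) <=
   (B * c * ((k < N)%N%:R * ratio ^+ k))%:E)%E.
Proof.
pose A : R := `|(pi *+ 2) ^- d * (2 * K) ^+ d|.
have A0 : 0 <= A by exact: normr_ge0.
pose W : R := mass + 1.
have W1 : 1 <= W by rewrite lerDr mass_ge0.
have P0 : 0 < P by rewrite (lt_le_trans ltr01).
exists (A * W + 1) => [|N r c k c0].
  by rewrite lerDr mulr_ge0// // (le_trans ler01).
have [w hw wle] := hasint_abs_eta_mass k r.
have w0 : 0 <= w by apply: (hasint_ge0 hw) => x.
have LE : LPpiece phi0 k (spike N r c) =1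
    (fun x => `|(pi *+ 2) ^- d * (2 * K) ^+ d * c * ((k < N)%N%:R * eta k r x)|).
  by move=> x; exact: (LPpiece_spike hK phi0P).
have hL : (Lpn P%:E (LPpiece phi0 k (spike N r c)) <=
    (A * c * (k < N)%N%:R * w `^ P^-1)%:E)%E.
  apply: (Lpn_le (e := fun x => `|eta k r x|) P1 _ _ _ _ hw).
  - apply: (proj2 (bmeasP _ _)); rewrite (funext LE).
    apply: measurableT_comp => //; apply: measurable_funM => //.
    by apply: measurable_funM => //; exact: measurable_eta.
  - by rewrite !mulr_ge0.
  - move=> x; rewrite LE normr_id !normrM (ger0_norm c0) (ger0_norm (ler0n _ _)).
    by rewrite /A normrM !mulrA.
  - by move=> x; rewrite normr_ge0 eta_le1.
apply: (le_trans (lee_wpmul2l _ hL)); first by rewrite lee_fin powR_ge0.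
rewrite -EFinM lee_fin.
have wP : w `^ P^-1 <= W * (2 `^ (- (d%:R / P))) ^+ k.
  have : w `^ P^-1 <= (mass * (2 ^+ d) ^- k) `^ P^-1.
    by apply: ge0_ler_powR; rewrite ?nnegrE ?invr_ge0 ?(ltW P0)// (le_trans w0).
  move/le_trans; apply; rewrite powRM ?mass_ge0 ?invr_ge0 ?exprn_ge0//.
  apply: ler_pM; rewrite ?powR_ge0//.
    apply: (@le_trans _ _ (W `^ P^-1)).
      apply: ge0_ler_powR; rewrite ?nnegrE ?invr_ge0 ?(ltW P0) ?mass_ge0//.
        by rewrite (le_trans ler01).
      by rewrite lerDl.
    by apply: ler1_powR => //; rewrite invf_le1.
  rewrite -exprM -powR_invn// -powRrM -powR_mulrn ?powR_ge0// -powRrM natrM.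
  by rewrite (_ : - (d%:R * k%:R) * P^-1 = - (d%:R / P) * k%:R)//; field; rewrite gt_eqF.
have -> : ratio ^+ k = 2 `^ (k%:R * s) * (2 `^ (- (d%:R / P))) ^+ k.
  rewrite /ratio powRD; last by rewrite pnatr_eq0 implybT.
  by rewrite exprMn; congr (_ * _); rewrite mulrC powRrM powR_mulrn ?powR_ge0.
set X := 2 `^ (k%:R * s); set Y := (_ ^+ k); set z := ((k < N)%N%:R : R).
have X0 : 0 <= X by exact: powR_ge0.
have Y0 : 0 <= Y by rewrite exprn_ge0// powR_ge0.
have z0 : 0 <= z by exact: ler0n.
have Acz : 0 <= X * (A * c * z) by rewrite !mulr_ge0.
rewrite [leLHS]mulrA (le_trans (ler_wpM2l Acz wP))// -/Y.
rewrite -subr_ge0 (_ : _ - _ = c * (z * (X * Y))); last by ring.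
by rewrite !mulr_ge0.
Qed.

End SpikeBesov.

(** * Spikes of unbounded height in the unit ball *)

Section SpikeFamily.
Context {R : realType} (n : nat).
Local Notation d := n.+1.
Local Notation RdT d := (g_sigma_algebraType (@rd_gen R d)).
Local Notation lambda := (@lebesgue_measure R).

Variable K : R.
Hypothesis hK : hasint lambda (@fejer R) K.
Variable phi0 : Rd R d -> R.
Hypothesis phi0P : is_phi0 phi0.

Lemma sum_geometric_le (x : R) m : 0 <= x < 1 ->
  \sum_(0 <= k < m) x ^+ k <= (1 - x)^-1.
Proof.
move=> /andP[x0 x1]; have y0 : 0 < 1 - x by rewrite subr_gt0.
rewrite -[leRHS]mul1r ler_pdivlMr// big_mkord mulrC -opprB mulNr -subrX1 opprB.
by rewrite gerBl exprn_ge0.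
Qed.

Section Fixed.
Variables (P s B : R).
Hypotheses (P1 : 1 <= P).
Hypothesis B1 : 1 <= B.
Hypothesis hB : forall N (r : Rd R d) c k, 0 <= c ->
  ((2 `^ (k%:R * s))%:E * Lpn P%:E (LPpiece phi0 k (spike N r c)) <=
   (B * c * ((k < N)%N%:R * ratio n P s ^+ k))%:E)%E.
Local Notation rho := (ratio n P s).
Hypothesis rho1 : rho <= 1.

Let rho0 : 0 <= rho. Proof. exact: powR_ge0. Qed.

Let x01 N k : 0 <= (k < N)%N%:R * rho ^+ k <= 1.
Proof.
rewrite mulr_ge0 ?exprn_ge0//=.
by case: ltnP => _; rewrite ?mul1r ?mul0r// exprn_ile1.
Qed.

Lemma besov_spike_infty N (r : Rd R d) c : 0 <= c -> B * c <= 1 ->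
  (besov phi0 s P%:E +oo (spike N r c) <= 1)%E.
Proof.
move=> c0 Bc; rewrite /besov eqxx; apply: ge_ereal_sup => _ [k _ <-].
apply: le_trans (hB N r k c0) _; rewrite lee_fin.
have /andP[h0 h1] := x01 N k.
by rewrite mulr_ile1// mulr_ge0// (le_trans ler01).
Qed.

(** Each normalised term lies in [0, 1], so its Q-th power is at most itself and the sum of powers
    is at most X / T^Q. [T] is the normalisation to be chosen in each regime. *)
Lemma besov_spike_fin N (r : Rd R d) c T X Q : 1 <= Q -> 0 < T -> 0 <= c ->
  B * c = T^-1 -> (forall m, \sum_(0 <= k < m) (k < N)%N%:R * rho ^+ k <= X) ->
  X <= T `^ Q -> (besov phi0 s P%:E Q%:E (spike N r c) <= 1)%E.
Proof.
move=> Q1 T0 c0 BcT hX XT.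
have Q0 : 0 < Q by rewrite (lt_le_trans ltr01).
pose a k := ((2 `^ (k%:R * s))%:E * Lpn P%:E (LPpiece phi0 k (spike N r c)))%E.
change (poweR (\sum_(0 <= k <oo) poweR (a k) Q)%E Q^-1 <= 1)%E.
suff : (\sum_(0 <= k <oo) poweR (a k) Q <= 1)%E.
  move=> hs; have -> : (1 = poweR 1 Q^-1 :> \bar R)%E by rewrite poweR_EFin powR1.
  apply: gt0_ler_poweR; rewrite ?in_itv/= ?invr_ge0 ?(ltW Q0) ?leey ?andbT//.
  by apply: nneseries_ge0 => k _ _; exact: poweR_ge0.
have ha k : (poweR (a k) Q <= (T `^ (- Q) * ((k < N)%N%:R * rho ^+ k))%:E)%E.
  have /andP[h0 h1] := x01 N k.
  apply: (@le_trans _ _ (poweR (B * c * ((k < N)%N%:R * rho ^+ k))%:E Q)).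
    apply: gt0_ler_poweR; rewrite ?in_itv/= ?(ltW Q0) ?leey ?andbT//.
    - rewrite /a; apply: mule_ge0; first by rewrite lee_fin powR_ge0.
      by rewrite /Lpn /=; exact: poweR_ge0.
    - by rewrite lee_fin mulr_ge0// mulr_ge0// (le_trans ler01).
    - exact: hB.
  rewrite poweR_EFin lee_fin BcT powRM ?invr_ge0 ?(ltW T0)//.
  rewrite -powR_inv1 ?(ltW T0)// -powRrM mulN1r ler_wpM2l ?powR_ge0//.
  by rewrite powR_le_self// h0.
apply: lime_le; first by apply: is_cvg_nneseries => k _ _; exact: poweR_ge0.
apply: nearW => m.
apply: (@le_trans _ _ (\sum_(0 <= k < m) (T `^ (- Q) * ((k < N)%N%:R * rho ^+ k))%:E)%E).
  by apply: lee_sum => k _.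
rewrite sumEFin lee_fin -mulr_sumr powRN ler_pdivrMl ?powR_gt0// mulr1.
exact: le_trans (hX m) XT.
Qed.

End Fixed.

Lemma archi_ex (x : R) : exists N : nat, x <= N%:R.
Proof. by exists (Num.truncn x).+1; rewrite ltW// truncnS_gt. Qed.

(** The amplitudes [c N] depend on the number of scales but not on the centre, which leaves the
    centre free to follow the sample. *)
Lemma spike_family (p q : \bar R) (s : R) :
  (1 <= p)%E -> (1 <= q)%E -> 0 < s ->
  ((s%:E * p < d%:R%:E)%E \/ ((s%:E * p)%E = d%:R%:E /\ (1 < q)%E)) ->
  exists c : nat -> R, [/\ forall N, 0 < c N <= 1,
    forall N (r : Rd R d), besov_ball phi0 s p q (spike N r (c N)) &
    forall M : R, exists N, M <= c N * N%:R].
Proof.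
case: p => [P| |] hp hq s0 hsdp; last 2 first.
(* p = +oo would make s * p infinite, neither below d nor equal to d. *)
- by case: hsdp => [|[]]; rewrite mulry gtr0_sg// mul1e.
- by move: hp; rewrite leeNy_eq.
rewrite lee_fin in hp.
have P0 : 0 < P by rewrite (lt_le_trans ltr01).
have inL N (r : Rd R d) c : inLp P%:E (spike N r c).
  split; last exact: (Lpn_spike_lty hK).
  by apply: (proj2 (bmeasP _ _)); exact: measurable_spike.
have [B B1 hB] := besov_spike_term hK phi0P s hp.
have B0 : 0 < B by rewrite (lt_le_trans ltr01).
have large T0 (M : R) : 0 < T0 -> exists N : nat, M <= T0^-1 * N%:R.
  by move=> T00; have [N hN] := archi_ex (M * T0); exists N; rewrite ler_pdivlMl// mulrC.
have cst01 (T : R) : 1 <= T -> 0 < (B * T)^-1 <= 1.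
  move=> T1; have T0 : 0 < T by rewrite (lt_le_trans ltr01).
  rewrite invr_gt0 mulr_gt0//= invf_le1 ?mulr_gt0//.
  by rewrite (le_trans B1)// ler_peMr// ltW.
have Bc (T : R) : 1 <= T -> B * (B * T)^-1 = T^-1.
  by move=> T1; rewrite invfM mulrA mulfV ?mul1r// gt_eqF.
have rho_lt1 : s * P < d%:R -> ratio n P s < 1.
  move=> h; have h1 : s - d%:R / P < 0 by rewrite subr_lt0 ltr_pdivlMr.
  rewrite /ratio /powR pnatr_eq0/= expR_lt1 pmulr_llt0//.
  by rewrite ln_gt0// ltr1n.
have rho_le1 : ratio n P s <= 1.
  rewrite -(powRr0 2) ler_powR ?ler1n// subr_le0 ler_pdivlMr//.
  case: hsdp => [|[+ _]]; rewrite -EFinM ?lte_fin; first exact: ltW.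
  by case=> ->.
case: q hq hsdp => [Q| |] hq hsdp; last 2 first.
(* For q = +oo the norm is a supremum of terms bounded by B * c, so a constant amplitude works even
   when s = d/p. *)
- exists (fun=> B^-1); split => [N|N r|M].
  + by have := cst01 1; rewrite mulr1 => /(_ (lexx _)).
  + split => //; apply: (besov_spike_infty B1 hB rho_le1) => //.
      by rewrite invr_ge0 ltW.
    by rewrite mulfV// gt_eqF.
  + exact: large.
- by move: hq; rewrite leeNy_eq.
rewrite lee_fin in hq; have Q0 : 0 < Q by rewrite (lt_le_trans ltr01).
case: hsdp => [|[_]]; rewrite -?EFinM lte_fin; [move=> /rho_lt1 rlt|move=> Q1].
  (* Subcritical case: the whole geometric series is at most T, and T <= T^Q since T >= 1, so the
     amplitude is again constant. *)
  pose T := (1 - ratio n P s)^-1.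
  have r0 : 0 <= ratio n P s by exact: powR_ge0.
  have T1 : 1 <= T by rewrite invf_ge1 ?subr_gt0// gerBl.
  have T0 : 0 < T by rewrite (lt_le_trans ltr01).
  exists (fun=> (B * T)^-1); split => [N|N r|M].
  + exact: cst01.
  + split => //.
    apply: (besov_spike_fin (X := T) B1 hB rho_le1 r hq T0 _ (Bc T T1)).
    * by have /andP[/ltW] := cst01 T T1.
    * move=> m; rewrite /T.
      apply: (@le_trans _ _ (\sum_(0 <= k < m) ratio n P s ^+ k)).
        apply: ler_sum => k _; case: ltnP => _; rewrite ?mul1r ?mul0r//.
        by rewrite exprn_ge0.
      by apply: sum_geometric_le; rewrite r0.
    * exact: le1r_powR.
  + by apply: large; rewrite mulr_gt0.
(* Critical case: N terms of size at most 1 sum to at most N <= T(N)^Q. The successor keeps T(N) >=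
   1 at N = 0. *)
pose T (N : nat) : R := N.+1%:R `^ Q^-1.
have T1 N : 1 <= T N.
  rewrite /T -[leLHS](powRr0 N.+1%:R) ler_powR ?invr_ge0 ?(ltW Q0)//.
  by rewrite ler1n.
have T0 N : 0 < T N by rewrite (lt_le_trans ltr01).
exists (fun N => (B * T N)^-1); split => [N|N r|M].
- exact: cst01.
- split => //.
  apply: (besov_spike_fin (X := N%:R) B1 hB rho_le1 r hq (T0 N) _ (Bc _ (T1 N))).
  + by have /andP[/ltW] := cst01 _ (T1 N).
  + elim=> [|m IH]; first by rewrite big_nil.
    case: (ltnP m N) => mN.
      apply: (@le_trans _ _ m.+1%:R); last by rewrite ler_nat.
      rewrite -[leRHS]/(m.+1%:R) -[in leRHS](subn0 m.+1) -sumr_const_nat.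
      apply: ler_sum => k _.
      rewrite mulr_ile1 ?exprn_ge0 ?powR_ge0 ?exprn_ile1 ?powR_ge0//.
      by case: ltnP.
    by rewrite big_nat_recr//= ltnNge mN mul0r addr0.
  + by rewrite /T -powRrM mulVf ?gt_eqF// powRr1// ler_nat.
(* Here Q > 1 is decisive: c N * N grows like N^th with th > 0. The factor 2 in the choice of N pays
   for replacing N+1 by N, as N >= 1. *)
pose th := 1 - Q^-1.
have th0 : 0 < th by rewrite subr_gt0 invf_lt1.
have [N hN] := archi_ex (Num.max 1 ((`|M| * B * 2) `^ th^-1)).
exists N.
have N1 : 1 <= N%:R :> R by apply: le_trans hN; rewrite le_max lexx.
have h2 : `|M| * B * 2 <= N.+1%:R `^ th.
  have b0 : 0 <= `|M| * B * 2 by rewrite !mulr_ge0// ltW.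
  have -> : `|M| * B * 2 = ((`|M| * B * 2) `^ th^-1) `^ th.
    by rewrite -powRrM mulVf ?gt_eqF// powRr1.
  apply: ge0_ler_powR; rewrite ?nnegrE ?(ltW th0) ?powR_ge0//.
  apply: (@le_trans _ _ N%:R); last by rewrite ler_nat.
  by apply: le_trans hN; rewrite le_max lexx orbT.
have TN : T N * N.+1%:R `^ th = N.+1%:R.
  by rewrite /T -powRD ?pnatr_eq0 ?implybT// /th addrC subrK powRr1.
apply: (le_trans (ler_norm M)).
rewrite mulrC ler_pdivlMr ?mulr_gt0//.
have : `|M| * B * 2 * T N <= N.+1%:R.
  by rewrite -TN mulrC ler_wpM2l// ltW.
rewrite -natr1 mulrA; move: N1; set y := N%:R; set z := `|M| * B * T N.
have -> : `|M| * B * 2 * T N = 2 * z by rewrite /z; ring.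
lra.
Qed.

End SpikeFamily.

(** * Pointwise bounds for spikes, at the centre and from below *)

Section SpikeLower.
Context {R : realType} (n : nat).
Local Notation d := n.+1.
Local Notation RdT d := (g_sigma_algebraType (@rd_gen R d)).

Lemma cos1_le (u : R) : `|u| <= 1 -> cos 1 <= cos u.
Proof.
move=> u1; rewrite -(cos_norm u).
have pi1 : 1 <= pi :> R by have := @pi_ge2 R; lra.
by rewrite leNgt ltr_cos ?in_itv/= -?leNgt ?normr_ge0 ?ler01 ?(le_trans u1).
Qed.

Definition floor_eta : R := (cos 1 / 2 * cos 1) ^+ d.

Lemma floor_eta_gt0 : 0 < floor_eta.
Proof. by rewrite exprn_gt0// !mulr_gt0 ?cos1_gt0 ?invr_gt0. Qed.

(** Width and carrier are at most 2^j, so all arguments of [fejer] and [cos] stay in [-1, 1], where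
    these are at least cos 1 / 2 and cos 1. *)
Lemma eta_near j (r x : Rd R d) : (forall i, 2 ^+ j * `|x i - r i| <= 1) ->
  floor_eta <= eta j r x.
Proof.
move=> h; rewrite /floor_eta /eta -[d in leLHS]card_ord -prodr_const.
apply: ler_prod => i _; have hi := h i.
have c1 := @cos1_gt0 R.
have small (e : R) : 0 <= e <= 1 -> `|e * 2 ^+ j * (x i - r i)| <= 1.
  move=> /andP[e0 e1]; rewrite !normrM (ger0_norm e0) ger0_norm ?exprn_ge0//.
  by rewrite -mulrA mulr_ile1// mulr_ge0// exprn_ge0.
rewrite !mulr_ge0 ?invr_ge0 ?(ltW c1)//=.
apply: ler_pM; rewrite ?mulr_ge0 ?invr_ge0 ?(ltW c1)//.
  apply: fejer_near0; apply: small; rewrite invr_ge0 mulr_ge0//=.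
  by rewrite invf_le1 ?mulr_gt0// ?ltr0n// -natrM ler1n.
by apply: cos1_le; apply: small; case: ifP => _; lra.
Qed.

(** Quadratic decay of a single Fejer factor suffices; the remaining factors are at most 1 in
    modulus. *)
Lemma eta_far j (r x : Rd R d) i : x i != r i ->
  `|eta j r x| <= 2 / (width n j * `|x i - r i|) ^+ 2.
Proof.
move=> xr; have wt : 0 < width n j * `|x i - r i| :> R.
  by rewrite mulr_gt0 ?width_gt0// normr_gt0 subr_eq0.
rewrite ler_pdivlMr ?exprn_gt0//.
apply: (@le_trans _ _ (fejer (width n j * (x i - r i)) * (width n j * `|x i - r i|) ^+ 2)).
  rewrite ler_wpM2r ?sqr_ge0// /eta (bigD1 i)//= normrM -[leRHS]mulr1.
  rewrite ler_pM ?kap_le// normr_prod.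
  apply: prodr_ile1 => k _ /=; rewrite normr_ge0 (le_trans (kap_le _ _ _))//.
  by rewrite (le_trans (fejer_le _))// invf_le1// ler1n.
rewrite exprMn real_normK ?num_real// -exprMn.
exact: fejer_decay.
Qed.

(** A majorant for the negative part of [eta j], with [u] the distance to the centre in units of
    2^-j: nothing near the centre, quadratic decay beyond. *)
Definition dip (C u : R) : R := if u <= 1 then 0 else C / u ^+ 2.

(** Dropping the first scale doubles [u], so induction applies with [u] general; 4/3 is the sum of
    the geometric series of ratio 1/4. *)
Lemma sum_dip_le (C u : R) N : 0 <= C -> 0 <= u ->
  \sum_(j < N) dip C (2 ^+ j * u) <=
  if u <= 1 then 4 / 3 * C else 4 / 3 * C / u ^+ 2.
Proof.
move=> C0; elim: N u => [|N IH] u u0.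
  rewrite big_ord0; case: ifP => _; first by rewrite mulr_ge0.
  by rewrite divr_ge0 ?sqr_ge0// mulr_ge0.
rewrite big_ord_recl expr0 mul1r.
have -> : \sum_(i < N) dip C (2 ^+ lift ord0 i * u) = \sum_(i < N) dip C (2 ^+ i * (2 * u)).
  by apply: eq_bigr => i _; rewrite lift0 exprSr mulrA.
have := IH (2 * u) (mulr_ge0 (ler0n _ 2) u0).
rewrite /dip; case: (leP u 1) => u1.
  rewrite add0r => /le_trans; apply; case: ifPn => //; rewrite -ltNge => u2.
  have C43 : 0 <= 4 / 3 * C by rewrite mulr_ge0.
  by rewrite ler_piMr// invf_le1 ?exprn_gt0 ?exprn_ege1 ?ltW// (lt_trans ltr01).
have /negbTE -> : ~~ (2 * u <= 1) by rewrite -ltNge; lra.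
have u_gt0 : 0 < u by rewrite (lt_trans ltr01).
have -> : 4 / 3 * C / (2 * u) ^+ 2 = 1 / 3 * (C / u ^+ 2) by field; rewrite gt_eqF.
have -> : 4 / 3 * C / u ^+ 2 = C / u ^+ 2 + 1 / 3 * (C / u ^+ 2) by field; rewrite gt_eqF.
by rewrite lerD2l.
Qed.

Definition depth : R := 4 / 3 * (2 * (10 * d%:R) ^+ 2).

Lemma depth_ge0 : 0 <= depth. Proof. by rewrite !mulr_ge0// exprn_ge0// mulr_ge0. Qed.

(** Coarse scales contribute positively and fine ones decay geometrically, hence a lower bound
    independent of the number of scales. *)
Lemma sum_eta_ge N (r x : Rd R d) : - depth <= \sum_(j < N) eta j r x.
Proof.
(* The coordinate farthest from the centre decides: if it is near at scale j, all are, and otherwise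
   it supplies the decay. *)
have [i0 _ hi0] := @Order.TotalTheory.arg_maxP _ R 'I_d ord0 xpredT
  (fun i => `|x i - r i|) isT.
set t := `|x i0 - r i0| in hi0; pose C : R := 2 * (10 * d%:R) ^+ 2.
have t0 : 0 <= t by exact: normr_ge0.
have C0 : 0 <= C by rewrite mulr_ge0// exprn_ge0// mulr_ge0.
have step j : - dip C (2 ^+ j * t) <= eta j r x.
  rewrite /dip; case: (leP (2 ^+ j * t) 1) => h.
    rewrite oppr0 (le_trans (ltW floor_eta_gt0))// eta_near// => i.
    by apply: le_trans h; rewrite ler_pM2l ?exprn_gt0//; exact: hi0.
  have xr : x i0 != r i0.
    apply: contraTneq h => e; rewrite /t e subrr normr0 mulr0.
    by rewrite -leNgt ler01.
  have t_neq0 : t != 0 by rewrite normr_eq0 subr_eq0.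
  have := eta_far j xr; rewrite ler_norml => /andP[+ _]; apply: le_trans.
  have D0 : d%:R != 0 :> R by rewrite pnatr_eq0.
  have E0 : 2 ^+ j != 0 :> R by rewrite expf_neq0// pnatr_eq0.
  rewrite lerN2 /width -/t /C; move: (d%:R) D0 (2 ^+ j) E0 => D D0 E E0.
  by rewrite le_eqVlt; apply/orP; left; apply/eqP; field; rewrite D0 E0 t_neq0.
have : - (\sum_(j < N) dip C (2 ^+ j * t)) <= \sum_(j < N) eta j r x.
  by rewrite -sumrN; apply: ler_sum => j _; exact: step.
apply: le_trans; rewrite lerN2 (le_trans (sum_dip_le N C0 t0))// /depth -/C.
case: (leP t 1) => // t1; rewrite ler_piMr ?mulr_ge0//.
by rewrite invf_le1 ?exprn_gt0 ?exprn_ege1 ?ltW// (lt_trans ltr01).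
Qed.

Lemma spike_ge N (r x : Rd R d) c : 0 <= c <= 1 -> - depth <= spike N r c x.
Proof.
move=> /andP[c0 c1]; apply: (@le_trans _ _ (c * - depth)); last first.
  by rewrite /spike ler_wpM2l// sum_eta_ge.
by rewrite mulrN lerN2 ler_piMl// depth_ge0.
Qed.

Lemma spike_near N (r x : Rd R d) c : 0 <= c ->
  (forall i, `|x i - r i| <= 2 ^- N) -> c * N%:R * floor_eta <= spike N r c x.
Proof.
move=> c0 h; rewrite /spike -mulrA ler_wpM2l//.
rewrite -[N in leLHS]card_ord -sumr_const mulr_suml; apply: ler_sum => j _.
rewrite mul1r; apply: eta_near => i.
rewrite -ler_pdivlMl ?exprn_gt0// mulr1 (le_trans (h i))//.
by rewrite lef_pV2 ?posrE ?exprn_gt0// ler_weXn2l ?ler1n// ltnW.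
Qed.

End SpikeLower.

(** * Null sets, means under P, and the sample *)

Section NullSets.
Context {R : realType} (n : nat).
Local Notation d := n.+1.
Local Notation RdT d := (g_sigma_algebraType (@rd_gen R d)).
Local Notation lambda := (@lebesgue_measure R).

Lemma lamE (A : set (Rd R d)) : borelRd A -> lam A = leb d A.
Proof.
move=> mA; rewrite /lam iintE.
- by rewrite integral_indic// setIT.
- by apply/measurable_EFinP; exact: measurable_indic.
- by move=> x; rewrite lee_fin.
Qed.

Variable g : Rd R d -> R.
Hypothesis gP : is_bdd_density g.

Let mg : measurable_fun setT (g : RdT d -> R).
Proof. by apply: (proj1 (bmeasP _ _)); case: gP. Qed.

Lemma PmE (A : set (Rd R d)) : borelRd A ->
  Pm g A = (\int[leb d]_x (\1_A x * g x)%:E)%E.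
Proof.
move=> mA; have [_ g0 _ _] := gP; rewrite /Pm iintE//.
- apply/measurable_EFinP; apply: measurable_funM; [exact: measurable_indic|exact: mg].
- by move=> x; rewrite lee_fin mulr_ge0.
Qed.

Lemma Pm_null (A : set (Rd R d)) : borelRd A -> lam A = 0%E -> Pm g A = 0%E.
Proof.
move=> mA; rewrite lamE// => A0; rewrite PmE//.
rewrite -(integral0 (leb d) setT); apply: ae_eq_integral => //.
- apply/measurable_EFinP; apply: measurable_funM; [exact: measurable_indic|exact: mg].
- exists A; split=> // x /= /not_implyP[_ h].
  by apply: contrapT => nAx; apply: h; rewrite indicE memNset// mul0r.
Qed.

Lemma PmT : Pm g setT = 1%E.
Proof.
have [_ _ _ <-] := gP; rewrite /Pm; congr iint; apply/funext => x.
by rewrite indicT mul1r.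
Qed.

(** On the exceptional P-null set the density vanishes Lebesgue-almost everywhere, so [f * g] and
    [h * g] agree almost everywhere. *)
Lemma Pmean_ae (f h : Rd R d -> R) v : pvers g h f -> bmeas h ->
  hasint (leb d) (fun x => h x * g x) v -> Pmean g f = v.
Proof.
move=> [/bmeasP mf [N [[A [mA NA A0]] hN]]] /bmeasP mh [_ hv].
have [_ g0 _ _] := gP.
rewrite /Pmean sintE; last first.
  by apply: (proj2 (bmeasP _ _)); exact: measurable_funM.
rewrite -[v]/(fine v%:E) -hv; congr fine.
apply: ae_eq_integral => //.
- by apply/measurable_EFinP; exact: measurable_funM.
- by apply/measurable_EFinP; exact: measurable_funM.
have mAg : measurable_fun setT (fun x : RdT d => \1_A x * g x).
  by apply: measurable_funM; [exact: measurable_indic|exact: mg].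
have : ae_eq (leb d) setT (EFin \o (fun x => \1_A x * g x)) (cst 0%E).
  apply/ae_eq_integral_abs => //; first exact/measurable_EFinP.
  rewrite -A0 PmE//; apply: eq_integral => x _ /=.
  by rewrite ger0_norm// mulr_ge0.
apply: filterS => x /= hx _; have {}hx := hx I.
have [Ax|nAx] := pselect (A x).
  move: hx; rewrite indicE mem_set// mul1r => -[->].
  by rewrite !mulr0.
by rewrite hN// => /NA.
Qed.

(** The bounded density turns an L^1 bound for Lebesgue measure into a bound on the mean. Whichever
    version of [u] the definition of [Pu] picks, it agrees with [h] off a union of two P-null
    sets. *)
Lemma Pu_bound (h u : Rd R d -> R) (M w : R) : bmeas h -> aeq (@lam R d) u h ->
  (forall x, g x <= M) -> hasint (leb d) (fun x => `|h x|) w -> `|Pu g u| <= M * w.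
Proof.
move=> mh [N2 [[A2 [mA2 NA2 A20]] uh]] gM hw.
have [_ g0 _ _] := gP.
have M0 : 0 <= M := le_trans (g0 (fun=> 0)) (gM _).
have w0 : 0 <= w by apply: (hasint_ge0 hw).
have mhg : measurable_fun setT (fun x : RdT d => h x * g x).
  by apply: measurable_funM => //; exact: (proj1 (bmeasP _ _)).
have [|v hv vle] := hasint_dominated mhg (hasintZ M hw).
  move=> x; rewrite normrM mulrC ler_wpM2r// (ger0_norm (g0 x)).
  exact: gM.
(* The closed branch is the default value 0 of [xget], which satisfies the bound trivially. *)
rewrite /Pu; case: xgetP => [m _ [f [[mf [N1 [[A1 [mA1 NA1 A10]] uf]]] ->]]|_]; last first.
  by rewrite normr0 mulr_ge0.
have mU : borelRd (A1 `|` A2) by exact: (@measurableU _ (RdT d) _ _ mA1 mA2).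
rewrite (@Pmean_ae f h v)//; split => //; exists (A1 `|` A2); split.
  exists (A1 `|` A2); split => //.
  apply/eqP; rewrite eq_le; apply/andP; split; last first.
    rewrite PmE//.
    by apply: integral_ge0 => x _; rewrite lee_fin mulr_ge0.
  have mI (A : set (RdT d)) : measurable A ->
      measurable_fun setT (fun x : RdT d => \1_A x * g x).
    by move=> mA; apply: measurable_funM; [exact: measurable_indic|exact: mg].
  have -> : 0%E = (Pm g A1 + Pm g A2)%E by rewrite A10 (Pm_null mA2)// adde0.
  rewrite !PmE//.
  rewrite -ge0_integralD//.
  - apply: ge0_le_integral => //.
    + by move=> x _; rewrite lee_fin mulr_ge0.
    + by apply/measurable_EFinP; exact: mI.
    + by apply: emeasurable_funD; apply/measurable_EFinP; exact: mI.
    + move=> x _; rewrite -EFinD lee_fin -mulrDl ler_wpM2r// !indicE in_setU.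
      by case: (x \in A1); case: (x \in A2); rewrite /= ?addr0 ?add0r// lerDl.
  - by move=> x _; rewrite lee_fin mulr_ge0.
  - by apply/measurable_EFinP; exact: mI.
  - by move=> x _; rewrite lee_fin mulr_ge0.
  - by apply/measurable_EFinP; exact: mI.
move=> x nx; rewrite -uf; last by move=> /NA1 ?; apply: nx; left.
by rewrite uh// => /NA2 ?; apply: nx; right.
Qed.

Lemma measurable_sample (k : nat) :
  measurable_fun setT (fun w : OmT R d => w k : RdT d).
Proof.
apply: measurable_fun_Rd => i _ B mB; rewrite setTI.
by apply: sub_sigma_algebra; exists k, i, B.
Qed.

(** Apply the product formula to k+1 factors that are all the full space except the last, whose
    probability is 0 by absolute continuity. *)
Lemma sample_null (Q : probability (OmT R d) R) (k : nat) (A : set (Rd R d)) :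
  is_product g Q -> borelRd A -> lam A = 0%E ->
  measurable ((fun w : OmT R d => w k) @^-1` A) /\
  Q ((fun w : OmT R d => w k) @^-1` A) = 0%E.
Proof.
move=> QP mA A0; split.
  by rewrite -[X in measurable X]setTI; apply: (measurable_sample k).
pose A' i := if i == k then A else setT.
have mA' i : borelRd (A' i).
  by rewrite /A'; case: eqP => _ //; exact: (@measurableT _ (RdT d)).
have := QP k.+1 A' mA'.
have A'k : A' k = A by rewrite /A' eqxx.
rewrite big_ord_recr/= A'k (Pm_null mA A0) mule0 => <-; congr (Q _).
apply/seteqP; split => [w /= Aw i _|w /(_ k (ltnSn k))]; last by rewrite A'k.
by rewrite /A'; case: eqP => [->|].
Qed.

End NullSets.

(** * The empirical process is almost surely unbounded *)

Section NotDonsker.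
Context {R : realType}.

Lemma oexp_ge1 d' (T : measurableType d') (Q : probability T R) (Z : T -> R) :
  (forall w, 1 <= Z w) -> (1 <= oexp Q Z)%E.
Proof.
move=> Z1; apply: le_ereal_inf_tmp => _ [Y [mY ZY] <-].
rewrite -(probability_setT Q) -[leLHS]mul1e -integral_cst//.
apply: ge0_le_integral => //.
by move=> w _; rewrite (le_trans _ (ZY w))// lee_fin.
Qed.

Lemma oexp_le0 d' (T : measurableType d') (Q : probability T R) (Z : T -> R) (E : set T) :
  measurable E -> Q E = 0%E -> (forall w, Z w <= \1_E w) -> (oexp Q Z <= 0)%E.
Proof.
move=> mE QE ZE; rewrite -QE; apply: ereal_inf_lbound.
exists (fun w => (\1_E w)%:E); last by rewrite integral_indic// setIT.
split; first by apply/measurable_EFinP; exact: measurable_indic.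
by move=> w; rewrite lee_fin.
Qed.

Variable n : nat.
Local Notation d := n.+1.
Local Notation RdT d := (g_sigma_algebraType (@rd_gen R d)).

(** The L^1 norms of the [eta j] decay like 2^(-dj) with d >= 1, so their sum is at most twice the
    bound at scale 0, for every N. *)
Lemma hasint_abs_spike_le K N (r : Rd R d) c :
  hasint (@lebesgue_measure R) (@fejer R) K -> 0 <= c <= 1 ->
  exists2 w, hasint (leb d) (fun x => `|spike N r c x|) w & w <= 2 * mass n K.
Proof.
move=> hK /andP[c0 c1]; have h j := hasint_abs_eta_mass hK j r.
have m0 := mass_ge0 n hK.
have hs := hasint_sum (index_enum 'I_N) (fun j : 'I_N => s2valP (cid2 (h j))).
have [||w hw wle] := @hasint_dominated _ _ _ (leb d) (fun x => `|spike N r c x|) _ _ _ hs.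
- by apply: measurableT_comp => //; exact: measurable_spike.
- move=> x; rewrite normr_id normrM ger0_norm//.
  by rewrite (le_trans (ler_wpM2l c0 (ler_norm_sum _ _ _)))// ler_piMl// sumr_ge0.
exists w => //; rewrite (le_trans (ler_norm w))// (le_trans wle)//.
pose y : R := (2 ^+ d)^-1.
have y0 : 0 < y by rewrite invr_gt0 exprn_gt0.
have y2 : y <= 2^-1.
  by rewrite lef_pV2 ?posrE ?exprn_gt0// exprS ler_peMr// exprn_ege1// ler1n.
apply: (@le_trans _ _ (\sum_(j < N) mass n K * y ^+ j)).
  by apply: ler_sum => j _; rewrite exprVn; exact: s2valP' (cid2 (h j)).
rewrite -mulr_sumr mulrC ler_wpM2r//.
have y1 : 0 <= y < 1 by rewrite ltW//=; lra.
have := sum_geometric_le N y1; rewrite big_mkord => /le_trans; apply.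
have z : 0 < 1 - y by lra.
by rewrite -[leLHS]mul1r ler_pdivrMr//; lra.
Qed.

Lemma rat_near (x : Rd R d) (e : R) : 0 < e ->
  exists r : {ffun 'I_d -> rat}, forall i, `|x i - ratr (r i)| <= e.
Proof.
move=> e0; have hc i : {c : rat | `|x i - ratr c| <= e}.
  have lt_x : x i - e < x i + e by lra.
  apply: cid; have [c] := rat_in_itvoo lt_x; rewrite in_itv/= => /andP[? ?].
  by exists c; rewrite ler_norml; apply/andP; split; lra.
by exists [ffun i => sval (hc i)] => i; rewrite ffunE; exact: svalP (hc i).
Qed.

Lemma not_donsker_succ (p q : \bar R) (s : R)
  (hp : (1 <= p)%E) (hq : (1 <= q)%E) (hs : 0 < s)
  (hsdp : (s%:E * p < d%:R%:E)%E \/ ((s%:E * p)%E = d%:R%:E /\ (1 < q)%E))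
  (phi0 : Rd R d -> R) (phi0P : is_phi0 phi0)
  (UU : set (Rd R d -> R)) (hUU : rep_set phi0 s p q UU)
  (g : Rd R d -> R) (gP : is_bdd_density g)
  (Q : probability (OmT R d) R) (QP : is_product g Q) : ~ donsker g UU Q.
Proof.
have [K hK] := @hasint_fejer_ex R.
have [c [c01 cball cinf]] := spike_family hK phi0P hp hq hs hsdp.
have c01' N : 0 <= c N <= 1 by have /andP[/ltW -> ->] := c01 N.
(* Rational centres make the family of spikes countable, so that the exceptional sets of all its
   members can be removed at once. *)
pose I := (nat * {ffun 'I_d -> rat})%type.
pose f (k : I) : Rd R d -> R := spike k.1 (fun i => ratr (k.2 i)) (c k.1).
have hu k : {u | UU u /\ aeq (@lam R d) u (f k)}.
  apply: cid; have [_ /(_ (f k) (cball _ _))[u [? _]]] := hUU.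
  by exists u.
pose u k := sval (hu k).
have hA k : {A | [/\ borelRd A, lam A = 0%E & forall x, ~ A x -> u k x = f k x]}.
  apply: cid; have [_ [N [[A [mA NA A0]] h]]] := svalP (hu k).
  by exists A; split => // x nAx; apply: h => /NA.
pose A k := sval (hA k).
(* Enumerates the events that a given observation falls into the exceptional set of a given
   spike. *)
pose F (m : nat) : set (OmT R d) :=
  if @unpickle (I * nat)%type m is Some ki then (fun w : OmT R d => w ki.2) @^-1` A ki.1
  else set0.
have FP m : measurable (F m) /\ Q (F m) = 0%E.
  rewrite /F; case: unpickle => [[k i]|] /=; last by split; [exact: measurable0|exact: measure0].
  by have [mA A0 _] := svalP (hA k); exact: (sample_null gP i QP mA A0).
pose E := \bigcup_m F m.
have mE : measurable E by apply: bigcup_measurable => m _; case: (FP m).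
have QE : Q E = 0%E.
  apply: measure_negligible => //; apply: negligible_bigcup => m.
  by have [? ?] := FP m; apply/negligibleP.
have uE w k i : ~ E w -> u k (w i) = f k (w i).
  move=> nEw; have [_ _ h] := svalP (hA k); apply: h => Aw; apply: nEw.
  by exists (pickle ((k, i) : I * nat)) => //; rewrite /F pickleK.
have [_ _ [G gG] _] := gP.
have Pb k : `|Pu g (u k)| <= G * (2 * mass n K).
  have [w hw wle] := hasint_abs_spike_le k.1 (fun i => ratr (k.2 i)) hK (c01' k.1).
  have mf : bmeas (f k) by apply: (proj2 (bmeasP _ _)); exact: measurable_spike.
  have [_ uf] := svalP (hu k).
  rewrite (le_trans (Pu_bound gP mf uf gG hw))// ler_wpM2l//.
  by have [_ g0 _ _] := gP; exact: le_trans (g0 (fun=> 0)) (gG _).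
have unbounded w m : ~ E w -> (0 < m)%N -> ~ bdd_on UU (fun v => empproc g m v w).
  move=> nEw m0 [M hM].
  pose D := G * (2 * mass n K).
  have m0' : 0 < m%:R :> R by rewrite ltr0n.
  (* The height at the first observation must beat the target |M| + 1, the bound D on the mean and
     the loss [depth] from each other observation, all scaled by m because of the average. *)
  have [N hN] := cinf (m%:R * (`|M| + D + depth n + 1) / floor_eta n).
  have e0 : (0 : R) < 2 ^- N by rewrite invr_gt0 exprn_gt0.
  have [r hr] := rat_near (w 0) e0.
  pose k : I := (N, r).
  have UUk : UU (u k) by case: (svalP (hu k)).
  have sum_ge : m%:R * (`|M| + D + 1) <= \sum_(i < m) u k (w i).
    case: m m0 m0' hN {hM} => [//|m] _ m0' hN.
    rewrite big_ord_recl uE//.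
    have h0 : m.+1%:R * (`|M| + D + depth n + 1) <= f k (w 0).
      apply: le_trans (spike_near (ltW _) hr); last by have /andP[] := c01 N.
      by rewrite -ler_pdivrMr ?floor_eta_gt0.
    have h1 : - (m%:R * depth n) <= \sum_(i < m) u k (w (lift ord0 i)).
      rewrite mulr_natl -mulNrn -[X in _ *+ X]card_ord -sumr_const.
      apply: ler_sum => i _.
      by rewrite uE// spike_ge.
    apply: le_trans (lerD h0 h1); rewrite -natr1.
    by rewrite -subr_ge0 (_ : _ - _ = depth n) ?depth_ge0//; ring.
  have := hM _ UUk; rewrite /empproc => hM'.
  have sq1 : 1 <= Num.sqrt m%:R :> R by rewrite -[leLHS]sqrtr1 ler_wsqrtr// ler1n.
  have X : `|M| + 1 <= m%:R^-1 * (\sum_(i < m) u k (w i)) - Pu g (u k).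
    have h2 : `|M| + D + 1 <= m%:R^-1 * (\sum_(i < m) u k (w i)).
      by rewrite ler_pdivlMl.
    by have := Pb k; rewrite -/D ler_norml => /andP[_]; lra.
  have : `|M| + 1 <= M.
    apply: le_trans hM'; apply: le_trans (ler_norm _).
    (* The centred average is nonnegative, so the factor sqrt m >= 1 can only increase it. *)
    apply: (le_trans X); rewrite ler_peMl//.
    by apply: le_trans X; rewrite addr_ge0.
  by have := ler_norm M; lra.
move=> [_ [d' [T [Q' [Gp [_ good conv]]]]]].
(* On bounded functions [h] is constant, hence continuous there; it detects whether a path belongs
   to l^oo at all. *)
pose h (z : (Rd R d -> R) -> R) : R := (`[< bdd_on UU z >])%:R.
have bch : bc_fun UU h.
  split.
  - by exists 1 => z; rewrite /h; case: asboolP; rewrite ?normr1 ?normr0.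
  - move=> z z' zz'; rewrite /h; congr (_%:R); congr nat_of_bool.
    apply: asbool_equiv_eq; split => -[M hM]; exists M => v UUv.
      by rewrite -zz'// hM.
    by rewrite zz'// hM.
  - move=> z e bz e0; exists 1 => // z' bz' _.
    by rewrite /h !asboolT// subrr normr0.
have := conv h bch => /cvg_lim cv.
have : (1 <= oexp Q' (fun w => h (fun v => Gp v w)))%E.
  apply: oexp_ge1 => w; rewrite /h asboolT//.
  by have [[M hM] _] := good w; exists M.
rewrite leNgt => /negP; apply; apply: (@le_lt_trans _ _ 0%E) => //.
rewrite -cv//; apply: lime_le; first by apply/cvg_ex; eexists; exact: conv.
near=> m; apply: (oexp_le0 mE QE) => w.
have [Ew|nEw] := pselect (E w).
  by rewrite indicE mem_set// /h; case: asboolP.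
rewrite /h asboolF ?indicE//; apply: unbounded => //.
(* The empty sample is excluded: a first observation is needed to place the spike. *)
by near: m; exists 1%N.
Unshelve. all: by end_near.
Qed.

End NotDonsker.

Theorem theorem7 (R : realType) (d : nat) (p q : \bar R) (s : R)
  (hp : (1 <= p)%E) (hq : (1 <= q)%E) (hs : 0 < s)
  (hsdp : (s%:E * p < d%:R%:E)%E \/ ((s%:E * p)%E = d%:R%:E /\ (1 < q)%E))
  (phi0 : Rd R d -> R) (hphi0 : @is_phi0 R d phi0)
  (UU : set (Rd R d -> R)) (hUU : @rep_set R d phi0 s p q UU)
  (g : Rd R d -> R) (hg : @is_bdd_density R d g)
  (Q : probability (OmT R d) R) (hQ : @is_product R d g Q) :
  ~ @donsker R d g UU Q.
Proof.
case: d hsdp phi0 hphi0 UU hUU g hg Q hQ => [|n] hsdp phi0 hphi0 UU hUU g hg Q hQ;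
  last exact: (not_donsker_succ hp hq hs hsdp hphi0 hUU hg hQ).
(* In dimension 0 the hypotheses contradict each other, since s * p > 0 is neither below nor equal
   to 0. *)
have p0 : (0 < p)%E := lt_le_trans lte01 hp.
have sp0 : (0 < s%:E * p)%E by rewrite mule_gt0.
by case: hsdp => [/(lt_trans sp0)|[e _]]; [rewrite ltxx|rewrite e ltxx in sp0].
Qed.
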